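(* Let $G$ be a Lie group that acts smoothly and properly on a smooth manifold $M$. Then $$H^1_d\left(G,C^\infty(M,\mathbb{R})\right)=\{0\}.$$
   Context: $C^\infty(M,\mathbb{R})$ carries the $C^\infty$-topology of maps and the $G$-action $(\alpha\cdot f)(x)=f(\alpha^{-1}x)$; it is a differentiable $G$-module. Lie groups need not be connected. For a differentiable $G$-module $W$, the differentiable cohomology $H^r_d(G,W)$ is the cohomology of the complex of smooth inhomogeneous cochains $C^r_d(G;W)=C^\infty(G^r,W)$ with the coboundary $\partial^0(w)(\alpha)=\alpha\cdot w-w$ and $$\partial^r\lambda(\alpha_1,\dots,\alpha_{r+1})=\alpha_1\cdot\lambda(\alpha_2,\dots,\alpha_{r+1})+\sum_{i=1}^r(-1)^i\lambda(\alpha_1,\dots,\alpha_i\alpha_{i+1},\dots,\alpha_{r+1})+(-1)^{r+1}\lambda(\alpha_1,\dots,\alpha_r).$$ *)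

(* Defs.v *)
From HB Require Import structures.
From mathcomp Require Import all_boot all_order all_algebra.
From mathcomp Require Import all_classical all_reals all_analysis.

Set Implicit Arguments.
Unset Strict Implicit.
Unset Printing Implicit Defensive.

Import Order.TTheory GRing.Theory Num.Theory.
Import numFieldTopology.Exports numFieldNormedType.Exports.

Local Open Scope classical_set_scope.
Local Open Scope ring_scope.

(* [dirderiv_at f x v w]: the derivative of f at x in the direction v is w.
   This is the difference quotient of the library's 'D_v f x, which is only
   available for targets that are normed modules; here W may be a function
   space with a non-normable topology. *)
Definition dirderiv_at (R : realType) (V : normedModType R)
    (W : preTopologicalLmodType R) (f : V -> W) (x v : V) (w : W) : Prop :=
  h^-1 *: (f (h *: v + x) - f x) @[h --> 0^'] --> w.

(* For V finite-dimensional and U open, C^k on U amounts to the existence and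
   continuity of all iterated directional derivatives of order at most k. *)
Fixpoint Ck_on (R : realType) (V : normedModType R)
    (W : preTopologicalLmodType R) (U : set V) (k : nat) (f : V -> W) : Prop :=
  {in U, continuous f} /\
  match k with
  | 0 => True
  | k'.+1 => forall v : V, exists2 g : V -> W,
      forall x, U x -> dirderiv_at f x v (g x) & Ck_on U k' g
  end.

Definition smooth_on (R : realType) (V : normedModType R)
    (W : preTopologicalLmodType R) (U : set V) (f : V -> W) : Prop :=
  forall k, Ck_on U k f.

(* A chart is given by total functions, meaningful only on its domain and on
   its image. *)
Record chart (T E : Type) := Chart {
  chart_dom : set T;
  chart_img : set E;
  chart_fun : T -> E;
  chart_inv : E -> T }.

Definition is_chart (R : realType) (E : normedModType R)
    (T : topologicalType) (phi : chart T E) : Prop :=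
  [/\ open (chart_dom phi), open (chart_img phi),
      set_fun (chart_dom phi) (chart_img phi) (chart_fun phi) /\
      set_fun (chart_img phi) (chart_dom phi) (chart_inv phi),
      {in chart_dom phi, cancel (chart_fun phi) (chart_inv phi)} /\
      {in chart_img phi, cancel (chart_inv phi) (chart_fun phi)} &
      {in chart_dom phi, continuous (chart_fun phi)} /\
      {in chart_img phi, continuous (chart_inv phi)}].

(* The expression of f in the charts phi and psi is meaningful only on the set
   passed to [smooth_on], which is open when f is continuous. *)
Definition smooth_in_charts (R : realType) (E F : normedModType R)
    (X Y : Type) (phi : chart X E) (psi : chart Y F) (f : X -> Y) : Prop :=
  smooth_on
    (chart_img phi `&` [set u | chart_dom psi (f (chart_inv phi u))])
    (fun u => chart_fun psi (f (chart_inv phi u))).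

Record smooth_manifold (R : realType) (n : nat) (M : topologicalType)
    (A : set (chart M 'rV[R]_n)) : Prop := SmoothManifold {
  manifold_hausdorff : hausdorff_space M;
  manifold_second_countable : @second_countable M;
  manifold_charts : forall phi, A phi -> is_chart phi;
  manifold_cover : forall x : M, exists2 phi, A phi & chart_dom phi x;
  manifold_compat : forall phi psi, A phi -> A psi ->
    smooth_in_charts phi psi id }.

Definition smooth_map (R : realType) (E F : normedModType R)
    (X Y : topologicalType) (A : set (chart X E)) (B : set (chart Y F))
    (f : X -> Y) : Prop :=
  continuous f /\
  forall phi psi, A phi -> B psi -> smooth_in_charts phi psi f.

Definition smooth_fun (R : realType) (E : normedModType R)
    (W : preTopologicalLmodType R) (X : Type) (A : set (chart X E))
    (f : X -> W) : Prop :=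
  forall phi, A phi -> smooth_on (chart_img phi) (f \o chart_inv phi).

Definition prod_chart (X Y E F : Type) (phi : chart X E) (psi : chart Y F) :
    chart (X * Y) (E * F) :=
  Chart (chart_dom phi `*` chart_dom psi) (chart_img phi `*` chart_img psi)
    (fun p => (chart_fun phi p.1, chart_fun psi p.2))
    (fun p => (chart_inv phi p.1, chart_inv psi p.2)).

Definition prod_atlas (X Y E F : Type) (A : set (chart X E))
    (B : set (chart Y F)) : set (chart (X * Y) (E * F)) :=
  [set prod_chart phi psi | phi in A & psi in B].

(* The product manifold X^r is modelled on r x n matrices, whose i-th row is the
   coordinate vector of the i-th factor. *)
Definition pow_chart (R : realType) (n r : nat) (X : Type)
    (phi : 'I_r -> chart X 'rV[R]_n) : chart ('I_r -> X) 'M[R]_(r, n) :=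
  Chart [set x | forall i, chart_dom (phi i) (x i)]
    [set u | forall i, chart_img (phi i) (row i u)]
    (fun x => \matrix_(i, j) chart_fun (phi i) (x i) 0 j)
    (fun u i => chart_inv (phi i) (row i u)).

Definition pow_atlas (R : realType) (n r : nat) (X : Type)
    (A : set (chart X 'rV[R]_n)) : set (chart ('I_r -> X) 'M[R]_(r, n)) :=
  [set pow_chart phi | phi in [set phi | forall i, A (phi i)]].

#[short(type="topGroupType")]
HB.structure Definition TopGroup := {G of Topological G & Group G}.

Record lie_group (R : realType) (n : nat) (G : topGroupType)
    (A : set (chart G 'rV[R]_n)) : Prop := LieGroup {
  lie_manifold : smooth_manifold A;
  lie_mul : smooth_map (prod_atlas A A) A (fun p : G * G => (p.1 * p.2)%g);
  lie_inv : smooth_map A A (fun g : G => g^-1%g) }.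

Record smooth_action (R : realType) (n m : nat)
    (G : topGroupType) (AG : set (chart G 'rV[R]_n))
    (M : topologicalType) (AM : set (chart M 'rV[R]_m))
    (rho : G -> M -> M) : Prop := SmoothAction {
  action1 : forall x, rho 1%g x = x;
  actionM : forall a b x, rho (a * b)%g x = rho a (rho b x);
  action_smooth :
    smooth_map (prod_atlas AG AM) AM (fun p : G * M => rho p.1 p.2) }.

Definition proper_map (X Y : topologicalType) (f : X -> Y) : Prop :=
  continuous f /\ forall K : set Y, compact K -> compact (f @^-1` K).

Definition proper_action (G M : topologicalType) (rho : G -> M -> M) : Prop :=
  proper_map (fun p : G * M => (rho p.1 p.2, p.2)).


Lemma Ck_on_cst (R : realType) (V : normedModType R) (U : set V) k (c : R^o) :
  Ck_on (W := R^o) U k (fun=> c).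
Proof.
elim: k c => [|k IHk] c /=; split => //; try by move=> x _; exact: cvg_cst.
move=> v; exists (fun=> 0) => [x _|]; last exact: IHk.
by rewrite /dirderiv_at (_ : (fun h => _) = cst 0);
  [exact: cvg_cst|apply/funext => h; rewrite subrr scaler0].
Qed.

Lemma Ck_on_lin (R : realType) (V : normedModType R) (U : set V) k (a : R)
    (f g : V -> R^o) :
  Ck_on U k f -> Ck_on U k g -> Ck_on U k (fun x => a *: f x + g x).
Proof.
have lin (h1 h2 : V -> R^o) x : {for x, continuous h1} ->
    {for x, continuous h2} -> {for x, continuous (fun x => a *: h1 x + h2 x)}.
  by move=> c1 c2; apply: cvgD => //; apply: cvgZr.
elim: k f g => [|k IHk] f g /= [cf df] [cg dg]; split => //;
  try by move=> x Ux; exact: lin (cf x Ux) (cg x Ux).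
move=> v; have [f' ff' Cf'] := df v; have [g' gg' Cg'] := dg v.
exists (fun x => a *: f' x + g' x) => [x Ux|]; last exact: IHk.
rewrite /dirderiv_at (_ : (fun h => _) = (fun h : R =>
    a *: (h^-1 *: (f (h *: v + x) - f x)) + h^-1 *: (g (h *: v + x) - g x))).
  by apply: cvgD; [apply: cvgZr; exact: ff'|exact: gg'].
apply/funext => h; rewrite !scalerA (mulrC a) -scalerA -scalerDr.
by congr (_ *: _); rewrite scalerBr opprD !addrA; congr (_ + _); rewrite addrAC.
Qed.

Section Cinfty.
Variables (R : realType) (m : nat) (M : topologicalType).
Variable A : set (chart M 'rV[R]_m).

Definition smooth_pred : {pred M -> R^o} := fun f => `[< smooth_fun A f >].

Lemma smooth_pred_submod : submod_closed smooth_pred.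
Proof.
split=> [|a f g /asboolP sf /asboolP sg]; apply/asboolP => phi Aphi k.
  exact: Ck_on_cst.
by apply: Ck_on_lin; [exact: sf|exact: sg].
Qed.

HB.instance Definition _ :=
  GRing.isSubmodClosed.Build R (M -> R^o) smooth_pred smooth_pred_submod.

Record Cinfty := MkCinfty {
  Cinfty_val :> M -> R^o;
  Cinfty_smooth : Cinfty_val \in smooth_pred }.

HB.instance Definition _ := [isSub for Cinfty_val].
HB.instance Definition _ := [Choice of Cinfty by <:].
HB.instance Definition _ := [SubChoice_isSubLmodule of Cinfty by <:].

(* The partial derivatives D_(v_1) ... D_(v_k) of f read in the chart phi. *)
Definition chart_derivative (phi : chart M 'rV[R]_m) (vs : seq 'rV[R]_m)
    (f : Cinfty) : 'rV[R]_m -> R^o :=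
  foldr (fun v u => 'D_v u) (f \o chart_inv phi) vs.

(* The C^oo topology: uniform convergence, on the compact subsets of the chart
   images, of each iterated partial derivative. *)
Definition Cinfty_topology : Type :=
  @sup_topology Cinfty ({phi | A phi} * seq 'rV[R]_m) (fun i =>
    Uniform.class (initial_topology (chart_derivative (sval i.1) i.2 :
      Cinfty -> {family (fun K => compact K /\ K `<=` chart_img (sval i.1)),
                   'rV[R]_m -> R^o}))).

HB.instance Definition _ := Uniform.copy Cinfty Cinfty_topology.

End Cinfty.

Section cohomology.
Variables (R : realType) (n : nat) (G : topGroupType).
Variable AG : set (chart G 'rV[R]_n).
Variables (W : preTopologicalLmodType R) (act : G -> W -> W).

Definition cochain (r : nat) : Type := ('I_r -> G) -> W.
HB.instance Definition _ r := GRing.Lmodule.on (cochain r).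

Definition smooth_cochains (r : nat) : set (cochain r) :=
  [set lam | smooth_fun (@pow_atlas R n r G AG) lam].

(* [merge i (a_0, ..., a_r)] = (a_0, ..., a_i a_(i+1), ..., a_r). *)
Definition merge (r : nat) (i : 'I_r) (a : 'I_r.+1 -> G) : 'I_r -> G :=
  fun j => if (j < i)%N then a (widen_ord (leqnSn r) j)
           else if j == i then (a (widen_ord (leqnSn r) j) * a (lift ord0 j))%g
           else a (lift ord0 j).

Definition coboundary (r : nat) (lam : cochain r) : cochain r.+1 :=
  fun a => act (a ord0) (lam (fun j => a (lift ord0 j)))
    + \sum_(i < r) (-1) ^+ i.+1 *: lam (merge i a)
    + (-1) ^+ r.+1 *: lam (fun j => a (widen_ord (leqnSn r) j)).

Definition cocycles (r : nat) : set (cochain r) :=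
  [set lam | smooth_cochains lam /\ coboundary lam = 0].

Definition coboundaries (r : nat) : set (cochain r) :=
  match r with
  | 0 => [set 0]
  | s.+1 => @coboundary s @` @smooth_cochains s
  end.

Definition cohomology_class (r : nat) (lam : cochain r) : set (cochain r) :=
  [set mu | coboundaries (mu - lam)].

(* The quotient of cocycles by coboundaries, as a set of cosets. *)
Definition cohomology (r : nat) : set (set (cochain r)) :=
  @cohomology_class r @` @cocycles r.

End cohomology.

Arguments coboundary {R G W} act {r} lam.
Arguments cocycles {R n G} AG {W} act r.
Arguments coboundaries {R n G} AG {W} act r.
Arguments cohomology_class {R n G} AG {W} act {r} lam.
Arguments cohomology {R n G} AG {W} act r.

(* (a . f)(x) = f(a^-1 x). The default value 0 is never taken when rho is a
   smooth action, as f \o rho a^-1 is then smooth. *)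
Definition Cinfty_act (R : realType) (m : nat) (G : topGroupType)
    (M : topologicalType) (A : set (chart M 'rV[R]_m)) (rho : G -> M -> M)
    (a : G) (f : Cinfty A) : Cinfty A :=
  insubd (0 : Cinfty A) (fun x => f (rho a^-1%g x)).

Arguments Cinfty_act {R m G M} A rho a f.

(* Main.v *)
Require Import Defs.
From mathcomp Require Import all_boot all_order all_algebra.
From mathcomp Require Import all_classical all_reals all_analysis.
From mathcomp Require Import ring lra.

Set Implicit Arguments.
Unset Strict Implicit.
Unset Printing Implicit Defensive.

Import Order.TTheory GRing.Theory Num.Theory.
Import numFieldTopology.Exports numFieldNormedType.Exports.

Local Open Scope classical_set_scope.
Local Open Scope ring_scope.

(** The cohomology class of a cocycle [lam], read as [c a x = lam a x] with
    [c (a b) x = c a x + c b (a^-1 x)], is killed by averaging over G. Let J be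
    a right-invariant Haar functional and b a compactly supported bump on M. As
    the action is proper, [H x = J (g |-> b (g x))] and
    [F x = J (g |-> c (g^-1) x * b (g x))] are well defined and smooth, H is
    invariant, and [F (a^-1 x) = F x - c a x * H x]. Countably many bumps [b_i]
    cover M, and the invariant functions
    [w_i = \prod_(j < i) sigma (1 / (i + 1) - H_j)], with sigma smooth and
    positive exactly on the positive reals, make the sums of the [w_i F_i] and
    of the [w_i H_i] locally finite, the latter being positive. Minus the
    quotient of these sums is a primitive of [lam].

    The Haar functional is obtained as in Weil and Cartan, from the covering
    ratios of a function by translates of a bump, the limit over shrinking
    bumps being taken along an ultrafilter. *)


(** * Haar functional *)

(** The group need not be compact and the orbit space need not be a manifold. Non-compactness forces
    the factor [b (g x)]: properness confines its support in [g] to a compact set, locally uniformly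
    in [x]. Gluing the averages over [M] must not destroy equivariance, so the gluing weights have
    to be invariant; instead of coming from a partition of unity on a quotient, they are made out of
    the invariant functions [H_j]. The cochain takes values in a function space that is in general
    not normable, and it is never differentiated in the group variable: only its continuity there is
    kept. Continuity for the C^oo topology makes each derivative along [M] jointly continuous, which
    is what differentiation under [J] asks for; hence a calculus with a merely continuous parameter.
    Only continuous compactly supported functions are integrated, so a positive linear functional
    serves as integral. Replacing [x] by [a x] in [b (g x)] multiplies [g] by [a] on the right,
    which is why right invariance is required; the inverse in [c (g^-1)] fits the cocycle identity
    to the same translation. *)

Lemma compact_induction (T : topologicalType) (K : set T) (P : set T -> Prop) :
  compact K -> P set0 ->
  (forall A B, P A -> P B -> P (A `|` B)) ->
  (forall A B, A `<=` B -> P B -> P A) ->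
  (forall x, K x -> exists2 A, nbhs x A & P A) -> P K.
Proof.
move=> cK P0 PU PS Pnbhs; apply: contrapT => nPK.
(* If [P K] fails, the sets whose complement in [K] satisfies [P] form a proper filter containing
   [K]. At a cluster point in [K], the local hypothesis puts the complement of a neighbourhood into
   this filter, a contradiction. *)
pose F : set_system T := [set A | P (K `\` A)].
have FF : ProperFilter F.
  apply: Build_ProperFilter.
    by rewrite /F /= setD0.
  split; first by rewrite /F /= setDT.
    by move=> A B FA FB; rewrite /F /= setDIr; exact: PU.
  by move=> A B AB; apply: PS; exact: setDS.
have [|x [Kx Fx]] := cK F FF; first by rewrite /F /= setDv.
have [A nA PA] := Pnbhs x Kx.
have FA : F (~` A) by apply: PS PA; rewrite setDE setCK; exact: subIsetr.
by have [y []] := Fx _ _ FA nA.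
Qed.

Section compact_support.
Variables (R : realType) (G : topologicalType).
Implicit Types (f g : G -> R).

Definition Cc f := continuous f /\
  exists2 K, compact K & forall x, ~ K x -> f x = 0.

Lemma Cc_lin a f g : Cc f -> Cc g -> Cc (fun x => a * f x + g x).
Proof.
move=> [cf [K cK fK]] [cg [L cL gL]]; split.
  move=> x; apply: cvgD; last exact: cg.
  by apply: cvgM; [exact: cvg_cst|exact: cf].
exists (K `|` L); first exact: compactU.
by move=> x /not_orP[nK nL]; rewrite fK// gL// mulr0 addr0.
Qed.

Lemma Cc0 : Cc (fun=> 0).
Proof. by split; [move=> x; exact: cvg_cst|exists set0 => //; exact: compact0]. Qed.

Lemma CcD f g : Cc f -> Cc g -> Cc (fun x => f x + g x).
Proof.
move=> /(Cc_lin 1) h /h; congr Cc; apply/funext => x; by rewrite mul1r.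
Qed.

Lemma CcZ a f : Cc f -> Cc (fun x => a * f x).
Proof.
move=> /(Cc_lin a)/(_ Cc0); congr Cc; apply/funext => x; by rewrite addr0.
Qed.

Lemma Cc_bounded f : Cc f -> exists2 B, 0 <= B & forall x, `|f x| <= B.
Proof.
move=> [cf [K cK fK]].
suff [B B0 KB] : exists2 B, 0 <= B & forall x, K x -> `|f x| <= B.
  exists B => // x; have [/KB //|/fK ->] := pselect (K x).
  by rewrite normr0.
apply: (@compact_induction _ K
  (fun A => exists2 B, 0 <= B & forall x, A x -> `|f x| <= B)) => //.
- by exists 0.
- move=> A B [a a0 Aa] [b b0 Bb]; exists (a + b) => [|x []]; first exact: addr_ge0.
    by move=> /Aa /le_trans -> //; rewrite lerDl.
  by move=> /Bb /le_trans -> //; rewrite lerDr.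
- by move=> A B AB [b b0 Bb]; exists b => // x /AB /Bb.
move=> x _; exists [set y | `|f x - f y| < 1].
  by have /cvgrPdist_lt/(_ _ ltr01) := cf x.
exists (`|f x| + 1) => [|y /= fxy]; first exact: addr_ge0.
have -> : f y = f x - (f x - f y) by rewrite opprB addrCA subrr addr0.
by rewrite (le_trans (ler_normB _ _))// lerD// ltW.
Qed.

(** Plays the role of local compactness together with Urysohn functions. On a manifold it comes from
    [manifold_bumps], and the construction of the functional sees the manifold structure of the
    group only through it and the Hausdorff property. *)
Definition bumps := forall p (V : set G), nbhs p V -> exists2 f : G -> R,
  [/\ continuous f, forall x, 0 <= f x & 0 < f p] &
  exists2 K, compact K /\ K `<=` V & forall x, ~ K x -> f x = 0.

(** Finitely many rescaled bumps add up to such a function. It replaces the indicator function of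
    [K] when a positive functional is estimated on functions living on [K]. *)
Lemma Cc_ge1 (K : set G) : bumps -> compact K ->
  exists2 f, Cc f /\ (forall x, 0 <= f x) & forall x, K x -> 1 <= f x.
Proof.
move=> bG cK; apply: (@compact_induction _ K (fun A =>
  exists2 f, Cc f /\ (forall x, 0 <= f x) & forall x, A x -> 1 <= f x)) => //.
- by exists (fun=> 0) => //; split => //; exact: Cc0.
- move=> A B [f [Cf f0] fA] [g [Cg g0] gB]; exists (fun x => f x + g x).
    by split=> [|x]; [exact: CcD|exact: addr_ge0].
  move=> x [/fA|/gB] h; rewrite (le_trans h)// ?lerDl ?lerDr//.
- by move=> A B AB [f ? fB]; exists f => // x /AB /fB.
move=> x _; have [f [cf f0 fx] [L [cL _] fL]] := bG x _ (@filterT _ (nbhs x) _).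
exists [set y | f x / 2 < f y].
  by apply: (cf x [set z | f x / 2 < z]); apply: lt_nbhsr; lra.
exists (fun y => 2 / f x * f y) => [|y /= h].
  split; first by apply: CcZ; split => //; exists L.
  by move=> y; rewrite mulr_ge0// divr_ge0// ltW.
rewrite -(@ler_pM2l _ (f x / 2)); last by rewrite divr_gt0.
have -> : f x / 2 * (2 / f x * f y) = f y by field; rewrite gt_eqF.
by rewrite mulr1; exact: ltW.
Qed.

End compact_support.

Section haar.
Variables (R : realType) (G : topGroupType).
Hypothesis mul_cont : continuous (fun p : G * G => (p.1 * p.2)%g).
Hypothesis inv_cont : continuous (fun g : G => g^-1%g).
Hypothesis hG : hausdorff_space G.
Hypothesis bG : bumps R G.
Implicit Types (f g phi psi : G -> R) (l : seq (R * G)).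

Lemma right_mul_continuous (s : G) : continuous (fun x : G => (x * s)%g).
Proof.
move=> x; apply: (@continuous_comp _ _ _ (fun x => (x, s))
  (fun p : G * G => p.1 * p.2)%g x); last exact: mul_cont.
by apply: cvg_pair; [exact: cvg_id|exact: cvg_cst].
Qed.

Lemma Cc_right_mul f s : Cc f -> Cc (fun x => f (x * s)%g).
Proof.
move=> [cf [K cK fK]]; split.
  move=> x; apply: (@continuous_comp _ _ _ (fun x => x * s)%g f x).
    exact: right_mul_continuous.
  exact: cf.
exists ((fun x => x * s^-1)%g @` K).
  by apply: continuous_compact => //; apply: continuous_subspaceT;
    exact: right_mul_continuous.
move=> x nx; apply: fK => Kx; apply: nx; exists (x * s)%g => //.
by rewrite mulgK.
Qed.

Definition Ccp f := Cc f /\ forall x, 0 <= f x.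

Lemma CcpD f g : Ccp f -> Ccp g -> Ccp (fun x => f x + g x).
Proof. by move=> [? ?] [? ?]; split=> [|x]; [exact: CcD|exact: addr_ge0]. Qed.

Lemma CcpZ a f : 0 <= a -> Ccp f -> Ccp (fun x => a * f x).
Proof. by move=> a0 [? ?]; split=> [|x]; [exact: CcZ|exact: mulr_ge0]. Qed.

Lemma Ccp_right_mul f s : Ccp f -> Ccp (fun x => f (x * s)%g).
Proof. by move=> [? ?]; split=> //; exact: Cc_right_mul. Qed.

Definition posf f := Ccp f /\ exists x, 0 < f x.

(* [l] lists pairs (c, s) standing for the translates c * phi (x s). *)
Definition majorized f phi l := (forall c, c \in l -> 0 <= c.1) /\
  forall x, f x <= \sum_(c <- l) c.1 * phi (x * c.2)%g.

Definition weight l : R := \sum_(c <- l) c.1.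

(* Weil's covering index (f : phi). It is right invariant and subadditive in f,
   but additive only in the limit of small supports of phi. *)
Definition cov f phi : R := inf [set weight l | l in majorized f phi].

Lemma majorant_ge0 l phi x : (forall c, c \in l -> 0 <= c.1) ->
  (forall x, 0 <= phi x) -> 0 <= \sum_(c <- l) c.1 * phi (x * c.2)%g.
Proof.
by move=> l0 p0; rewrite big_seq sumr_ge0// => c /l0 c0; rewrite mulr_ge0.
Qed.

Lemma weight_ge0 f phi l : majorized f phi l -> 0 <= weight l.
Proof. by move=> [l0 _]; rewrite /weight big_seq sumr_ge0. Qed.

Lemma majorized_ex f phi : Ccp f -> posf phi -> exists l, majorized f phi l.
Proof.
move=> [[cf [K cK fK]] f0] [[[cphi _] phi0] [p p0]].
suff [l [l0 lK]] : exists l, (forall c, c \in l -> 0 <= c.1) /\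
    forall x, K x -> f x <= \sum_(c <- l) c.1 * phi (x * c.2)%g.
  exists l; split=> // x; have [/lK //|/fK ->] := pselect (K x).
  exact: majorant_ge0.
apply: (@compact_induction _ K (fun A =>
  exists l, (forall c, c \in l -> 0 <= c.1) /\
    forall x, A x -> f x <= \sum_(c <- l) c.1 * phi (x * c.2)%g)) => //.
- by exists [::].
- move=> A B [l [l0 lA]] [l' [l'0 lB]]; exists (l ++ l'); split.
    by move=> c; rewrite mem_cat => /orP[/l0|/l'0].
  move=> x; rewrite big_cat /= => -[/lA|/lB] h; rewrite (le_trans h)//.
    by rewrite lerDl majorant_ge0.
  by rewrite lerDr majorant_ge0.
- by move=> A B AB [l [l0 lB]]; exists l; split=> // x /AB /lB.
move=> x _.
(* The translate of [phi] by [x^-1 p] takes at [x] the value [phi p], so it exceeds [phi p / 2]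
   nearby; one multiple of it dominates [f] around [x]. *)
exists ([set y | f y < f x + 1] `&` [set y | phi p / 2 < phi (y * (x^-1 * p))%g]).
  apply: filterI.
    by apply: (cf x [set z | z < f x + 1]); apply: lt_nbhsl; rewrite ltrDl.
  have c : {for x, continuous (fun y => y * (x^-1 * p))%g} by exact:
    right_mul_continuous.
  apply: (c [set z | phi p / 2 < phi z]).
  apply: (cphi _ [set z | phi p / 2 < z]); apply: lt_nbhsr.
  by rewrite mulVKg; lra.
exists [:: ((f x + 1) / (phi p / 2), (x^-1 * p)%g)]; split.
  move=> c; rewrite inE => /eqP -> /=.
  by rewrite divr_ge0// ?addr_ge0// divr_ge0// ltW.
move=> y [/= fy py]; rewrite big_seq1 /=.
rewrite (le_trans (ltW fy))// -mulrA ler_peMr ?addr_ge0//.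
by rewrite ler_pdivlMl ?divr_gt0// mulr1 ltW.
Qed.

Lemma cov_lbound f phi : has_lbound [set weight l | l in majorized f phi].
Proof. by exists 0 => _ [l ml <-]; exact: weight_ge0 ml. Qed.

Lemma cov_le f phi l : majorized f phi l -> cov f phi <= weight l.
Proof. by move=> ml; apply: ge_inf; [exact: cov_lbound|exists l]. Qed.

Lemma cov_ge f phi y : Ccp f -> posf phi ->
  (forall l, majorized f phi l -> y <= weight l) -> y <= cov f phi.
Proof.
move=> Cf pphi h; apply: lb_le_inf.
  by have [l ml] := majorized_ex Cf pphi; exists (weight l), l.
by move=> _ [l ml <-]; exact: h.
Qed.

Lemma cov_right_mul_le f phi s : Ccp f -> posf phi ->
  cov (fun x => f (x * s)%g) phi <= cov f phi.
Proof.
move=> Cf pphi; apply: cov_ge => // l [l0 lf].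
have -> : weight l = weight [seq (c.1, (s * c.2)%g) | c <- l].
  by rewrite /weight big_map.
apply: cov_le; split=> [c /mapP[d /l0 ? ->] //|x].
rewrite big_map (le_trans (lf _))// le_eqVlt; apply/orP; left; apply/eqP.
by apply: eq_bigr => c _; rewrite mulgA.
Qed.

Lemma cov_right_mul f phi s : Ccp f -> posf phi ->
  cov (fun x => f (x * s)%g) phi = cov f phi.
Proof.
move=> Cf pphi; apply/eqP; rewrite eq_le cov_right_mul_le//=.
have := cov_right_mul_le s^-1%g (Ccp_right_mul s Cf) pphi.
by under eq_fun do rewrite mulgVK.
Qed.

Lemma covD_le f g phi : Ccp f -> Ccp g -> posf phi ->
  cov (fun x => f x + g x) phi <= cov f phi + cov g phi.
Proof.
move=> Cf Cg pphi; rewrite -lerBlDr; apply: cov_ge => // l [l0 lf].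
rewrite lerBlDr -lerBlDl; apply: cov_ge => // l' [l'0 lg].
rewrite lerBlDl /weight -big_cat; apply: cov_le; split=> [c|x].
  by rewrite mem_cat => /orP[/l0|/l'0].
by rewrite big_cat lerD.
Qed.

Lemma covZ_le a f phi : 0 < a -> Ccp f -> posf phi ->
  cov (fun x => a * f x) phi <= a * cov f phi.
Proof.
move=> a0 Cf pphi; rewrite -ler_pdivrMl//; apply: cov_ge => // l [l0 lf].
rewrite ler_pdivrMl//.
have -> : a * weight l = weight [seq (a * c.1, c.2) | c <- l].
  by rewrite /weight big_map mulr_sumr.
apply: cov_le; split=> [c /mapP[d /l0 ? ->]|x].
  by rewrite /= mulr_ge0// ltW.
rewrite big_map (@le_trans _ _ (a * \sum_(c <- l) c.1 * phi (x * c.2)%g))//.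
  by rewrite ler_pM2l.
by rewrite mulr_sumr ler_sum// => c _; rewrite /= mulrA.
Qed.

Lemma covZ a f phi : 0 < a -> Ccp f -> posf phi ->
  cov (fun x => a * f x) phi = a * cov f phi.
Proof.
move=> a0 Cf pphi; apply/eqP; rewrite eq_le covZ_le//=.
have ai0 : 0 < a^-1 by rewrite invr_gt0.
have := covZ_le ai0 (CcpZ (ltW a0) Cf) pphi.
rewrite -(ler_pM2l a0) mulrA divff ?gt_eqF// mul1r.
by under eq_fun do rewrite mulKf ?gt_eqF//.
Qed.

(** Inserting a majorant of [phi] by translates of [psi] into one of [f] by translates of [phi]
    multiplies the weights. This gives both bounds on the normalised index below. *)
Lemma cov_trans f phi psi : Ccp f -> posf phi -> posf psi ->
  cov f psi <= cov f phi * cov phi psi.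
Proof.
move=> Cf pphi ppsi.
have key l : majorized f phi l -> cov f psi <= weight l * cov phi psi.
  move=> ml; have [l0 lf] := ml; have wl := weight_ge0 ml.
  (* The estimate divides by the weight. When it is 0, all coefficients vanish, so [f <= 0] and [l]
     also majorizes [f] by translates of [psi]. *)
  have [w0|w0] := eqVneq (weight l) 0.
    rewrite w0 mul0r -w0; apply: cov_le; split=> // x.
    move: (lf x).
    have l00 : forall c, c \in l -> c.1 = 0.
      move=> c cl; apply/eqP; rewrite eq_le l0// andbT -w0 /weight.
      rewrite (perm_big _ (perm_to_rem cl)) big_cons /= lerDl big_seq sumr_ge0//.
      by move=> d /mem_rem/l0.
    rewrite big_seq big1 => [fx|c /l00 ->]; last by rewrite mul0r.
    rewrite big_seq big1 => [//|c /l00 ->]; by rewrite mul0r.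
  rewrite -ler_pdivrMl ?lt_neqAle ?wl ?andbT 1?eq_sym//.
  have Cphi : Ccp phi by case: pphi.
  apply: cov_ge => // l' [l'0 lphi].
  rewrite ler_pdivrMl ?lt_neqAle ?wl ?andbT 1?eq_sym//.
  pose L := [seq (c.1 * d.1, (c.2 * d.2)%g) | c <- l, d <- l'].
  have -> : weight l * weight l' = weight L.
    rewrite /weight big_allpairs_dep mulr_suml; apply: eq_bigr => c _.
    by rewrite mulr_sumr.
  apply: cov_le; split=> [c /allpairsP[[d e] [/l0 ? /l'0 ? ->]]|x].
    exact: mulr_ge0.
  rewrite (le_trans (lf x))// big_allpairs_dep big_seq [leRHS]big_seq ler_sum// => c cl.
  rewrite (@le_trans _ _ (c.1 * \sum_(d <- l') d.1 * psi (x * c.2 * d.2)%g))//.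
    by rewrite ler_wpM2l// l0.
  by rewrite mulr_sumr ler_sum// => d _; rewrite /= mulrA -mulgA.
have [c0|c0] := ltP 0 (cov phi psi).
  rewrite -ler_pdivrMr//; apply: cov_ge => // l ml.
  by rewrite ler_pdivrMr// key.
have cphi0 : cov phi psi = 0.
  apply/eqP; rewrite eq_le c0 /=; apply: cov_ge => //; first by case: pphi.
  by move=> l ml; exact: weight_ge0 ml.
have [l ml] := majorized_ex Cf pphi.
by rewrite (le_trans (key _ ml))// cphi0 !mulr0.
Qed.

Lemma cov_ge0 f phi : Ccp f -> posf phi -> 0 <= cov f phi.
Proof. by move=> Cf pp; apply: cov_ge => // l ml; exact: weight_ge0 ml. Qed.

(** Evaluated at a point where [f p > 0], a majorant has weight at least [f p / B], where [B] bounds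
    [phi]. *)
Lemma cov_gt0 f phi : posf f -> posf phi -> 0 < cov f phi.
Proof.
move=> [Cf [p fp]] pphi; have [[Cphi phi0] [q phiq]] := pphi.
have [B B0 phiB] := Cc_bounded Cphi.
have {}B0 : 0 < B.
  by rewrite (lt_le_trans phiq)// (le_trans (ler_norm _))// phiB.
rewrite (@lt_le_trans _ _ (f p / B)) ?divr_gt0//.
apply: cov_ge => // l [l0 lf]; rewrite ler_pdivrMr//.
rewrite (le_trans (lf p))// /weight mulr_suml big_seq [leRHS]big_seq ler_sum// => c
  /l0 cl.
by rewrite ler_wpM2l// (le_trans (ler_norm _)).
Qed.

Lemma Cc_uniform f e : Cc f -> 0 < e ->
  exists2 V, nbhs (1%g : G) V & forall x v, V v -> `|f x - f (v^-1 * x)%g| < e.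
Proof.
move=> [cf [K cK fK]] e0.
have : \forall v \near (1%g : G), K `<=` [set x | `|f x - f (v * x)%g| < e].
  apply: (@iffLR _ _ (compact_near_coveringP K) cK _ _
    (fun v x => `|f x - f (v * x)%g| < e)) => x _.
  have c : {for (x, 1%g : G), continuous
      (fun p : G * G => f p.1 - f (p.2 * p.1)%g)}.
    apply: cvgB; first by apply: (@continuous_comp _ _ _ fst f);
      [exact: cvg_fst|exact: cf].
    apply: (@continuous_comp _ _ _ (fun p => p.2 * p.1)%g f); last exact: cf.
    apply: (@continuous_comp _ _ _ (fun p : G * G => (p.2, p.1))
      (fun p : G * G => p.1 * p.2)%g); last exact: mul_cont.
    by apply: cvg_pair; [exact: cvg_snd|exact: cvg_fst].
  have : \forall p \near (x, 1%g : G), `|f p.1 - f (p.2 * p.1)%g| < e.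
    apply: (c [set z | `|z| < e]) => /=.
    rewrite mul1g subrr; apply/nbhs_ballP; exists e => //= z.
    by rewrite /ball /= sub0r normrN.
  by [].
(* Both [v] and [v^-1] are kept near 1: when [x] is outside the support but [v^-1 x] inside, the
   estimate is applied at [v^-1 x] with the shift [v]. *)
move=> KV; exists ([set v | K `<=` [set x | `|f x - f (v * x)%g| < e]] `&`
  [set v | K `<=` [set x | `|f x - f (v^-1 * x)%g| < e]]).
  apply: filterI => //.
  have := @inv_cont 1%g ([set v | K `<=` [set x | `|f x - f (v * x)%g| < e]]).
  by rewrite invg1; apply.
move=> x v [/= V1 V2]; have [Kx|Kx] := pselect (K x); first exact: V2.
have [Kv|Kv] := pselect (K (v^-1 * x)%g).
  by have /= := V1 _ Kv; rewrite mulVKg distrC.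
by rewrite (fK _ Kx) (fK _ Kv) subrr normr0.
Qed.

(** Off [K] the denominator may vanish, but there the quotient is locally 0: [K] is closed because
    [G] is Hausdorff, and 0 divided by 0 is 0. *)
Lemma Cc_quot f (h : G -> R) : Cc f -> continuous h ->
  (exists2 K, compact K & (forall x, ~ K x -> f x = 0) /\
                          (forall x, K x -> 0 < h x)) ->
  Cc (fun x => f x / h x).
Proof.
move=> [cf _] ch [K cK [fK hK]]; split; last first.
  by exists K => // x /fK ->; rewrite mul0r.
move=> x; have [Kx|nKx] := pselect (K x).
  apply: cvgM; first exact: cf.
  by apply: cvgV; [rewrite gt_eqF// hK|exact: ch].
have oK : nbhs x (~` K).
  by apply: open_nbhs_nbhs; split=> //; apply: closed_openC; exact: compact_closed.
rewrite /continuous_at fK// mul0r; apply: cvg_near_cst.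
by apply: filterS oK => y /fK ->; rewrite mul0r.
Qed.

(** Write [f = h * (f / h)] and majorize [h]. A term [phi (x * s)] is nonzero only if [v = x * s]
    lies in [V]; then [v^-1 * x = s^-1], so [f / h] at [x] is at most its value at [s^-1] plus [eta]
    and can be absorbed into the coefficient. *)
Lemma majorized_split f (h : G -> R) phi l eta V : posf phi ->
  (forall x, 0 <= f x <= h x) ->
  (forall x v, V v -> `|f x / h x - f (v^-1 * x)%g / h (v^-1 * x)%g| < eta) ->
  (forall x, phi x != 0 -> V x) -> 0 < eta -> majorized h phi l ->
  cov f phi <= \sum_(c <- l) c.1 * (f (c.2^-1)%g / h (c.2^-1)%g + eta).
Proof.
move=> [[_ phi0] _] fh Vq phiV eta0 [l0 hl].
have q0 x : 0 <= f x / h x.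
  by have /andP[f0 fhx] := fh x; rewrite divr_ge0// (le_trans f0).
pose L := [seq (c.1 * (f (c.2^-1)%g / h (c.2^-1)%g + eta), c.2) | c <- l].
have -> : \sum_(c <- l) c.1 * (f (c.2^-1)%g / h (c.2^-1)%g + eta) = weight L.
  by rewrite /weight big_map.
apply: cov_le; split=> [c /mapP[d /l0 d0 ->]|x].
  by rewrite /= mulr_ge0// addr_ge0// ltW.
(* Where [h x = 0] the bounds force [f x = 0], so the quotient by 0 is harmless. *)
have fE : f x = h x * (f x / h x).
  have [h0|h0] := eqVneq (h x) 0; last by rewrite mulrC divfK.
  by have := fh x; rewrite h0 -eq_le mul0r => /eqP <-.
rewrite fE (@le_trans _ _ ((\sum_(c <- l) c.1 * phi (x * c.2)%g) * (f x / h x)))//.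
  by rewrite ler_wpM2r.
rewrite big_map mulr_suml big_seq [leRHS]big_seq ler_sum// => c /l0 c0 /=.
have [->|p0] := eqVneq (phi (x * c.2)%g) 0; first by rewrite !(mulr0, mul0r).
rewrite mulrAC ler_wpM2r// ler_wpM2l//.
have /(Vq x) := phiV _ p0.
rewrite invgM mulgVK => /ltW; rewrite ler_norml => /andP[_].
by rewrite lerBlDl.
Qed.

Variable f0 : G -> R.
Hypothesis pf0 : posf f0.

(** The index itself blows up or degenerates as [phi] shrinks. Divided by that of a fixed [f0], it
    stays between two bounds independent of [phi]. *)
Let ncov f phi : R := cov f phi / cov f0 phi.

Lemma ncov_ge0 f phi : Ccp f -> posf phi -> 0 <= ncov f phi.
Proof. by move=> Cf pp; rewrite divr_ge0// cov_ge0//; case: pf0. Qed.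

Lemma ncov_le f phi : Ccp f -> posf phi -> ncov f phi <= cov f f0.
Proof.
by move=> Cf pp; rewrite ler_pdivrMr ?cov_gt0//; exact: cov_trans.
Qed.

Lemma ncov_ge f phi : posf f -> posf phi -> (cov f0 f)^-1 <= ncov f phi.
Proof.
move=> pf pp; rewrite /ncov ler_pdivlMr ?cov_gt0// ler_pdivrMl ?cov_gt0//.
by apply: cov_trans => //; case: pf0.
Qed.

(* Dividing f and g by h = f + g + delta * chi, where chi >= 1 on their supports,
   gives two uniformly continuous functions of sum at most 1: when phi lives near
   1, a majorant of h splits into one of f and one of g, up to eta. *)
Lemma ncov_almost_superadditive f g e : Ccp f -> Ccp g -> 0 < e ->
  exists2 V, nbhs (1%g : G) V & forall phi, posf phi ->
    (forall x, phi x != 0 -> V x) ->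
    ncov f phi + ncov g phi <= ncov (fun x => f x + g x) phi + e.
Proof.
move=> Cf Cg e0.
have [[cf [Kf cKf fK]] f_ge0] := Cf; have [[cg [Kg cKg gK]] g_ge0] := Cg.
have cK := compactU cKf cKg.
have [chi [Cchi chi0] chi1] := Cc_ge1 bG cK.
have Cfg := CcpD Cf Cg.
pose A := cov (fun x => f x + g x) f0; pose B := cov chi f0.
have A0 : 0 <= A by exact: cov_ge0.
have B0 : 0 <= B by exact: cov_ge0.
have fourth (a : R) : 0 <= a -> e / (4 * (a + 1)) * a <= e / 4.
  move=> a0; have a1 : 0 < a + 1 by rewrite ltr_wpDl.
  rewrite -subr_ge0; have -> : e / 4 - e / (4 * (a + 1)) * a = e / (4 * (a + 1)).
    by field; rewrite gt_eqF.
  by rewrite divr_ge0// ltW// mulr_gt0.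
(* [A] and [B] bound [ncov] of [f + g] and of [chi] for every [phi]. With [a] the former and [b]
   equal to [delta] times the latter, the error [2 eta a + b + 2 eta b] is at most
   [e / 2 + e / 4 + e / 4]. *)
pose delta := e / (4 * (B + 1)).
pose eta := Num.min (2^-1) (e / (4 * (A + 1))).
have delta0 : 0 < delta by rewrite divr_gt0// mulr_gt0// ltr_wpDl.
have eta0 : 0 < eta by rewrite lt_min invr_gt0 ltr0n /= divr_gt0// mulr_gt0// ltr_wpDl.
have eta_half : eta <= 2^-1 by rewrite ge_min lexx.
have etaA : eta * A <= e / 4.
  apply: (@le_trans _ _ (e / (4 * (A + 1)) * A)).
    by rewrite ler_wpM2r// ge_min lexx orbT.
  exact: fourth.
have deltaB : delta * B <= e / 4 by exact: fourth.
pose h x := f x + g x + delta * chi x.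
have Ch : Ccp h by apply: CcpD => //; apply: CcpZ; [exact: ltW|split].
have ch : continuous h by case: Ch => -[].
have hK x : (Kf `|` Kg) x -> 0 < h x.
  move=> /chi1 c1; rewrite ltr_wpDl ?addr_ge0//.
  by rewrite mulr_gt0// (lt_le_trans ltr01).
have fh x : 0 <= f x <= h x.
  by rewrite f_ge0 /= /h -addrA lerDl addr_ge0// mulr_ge0// ltW.
have gh x : 0 <= g x <= h x.
  by rewrite g_ge0 /= /h addrAC lerDr addr_ge0// mulr_ge0// ltW.
have Cq1 : Cc (fun x => f x / h x).
  apply: Cc_quot => //; first by case: Cf.
  by exists (Kf `|` Kg) => //; split=> // x /not_orP[/fK].
have Cq2 : Cc (fun x => g x / h x).
  apply: Cc_quot => //; first by case: Cg.
  by exists (Kf `|` Kg) => //; split=> // x /not_orP[_ /gK].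
have [V1 nV1 V1q] := Cc_uniform Cq1 eta0.
have [V2 nV2 V2q] := Cc_uniform Cq2 eta0.
exists (V1 `&` V2); first exact: filterI.
move=> phi pp phiV.
have key l : majorized h phi l ->
    cov f phi + cov g phi <= (1 + 2 * eta) * weight l.
  move=> ml.
  have lf := @majorized_split f h phi l eta V1 pp fh V1q _ eta0 ml.
  have lg := @majorized_split g h phi l eta V2 pp gh V2q _ eta0 ml.
  apply: (le_trans (lerD (lf _) (lg _))); [by move=> x /phiV []|by move=> x /phiV []|].
  rewrite -big_split /weight mulr_sumr /= big_seq [leRHS]big_seq ler_sum// => c.
  case: ml => l0 _ /l0 c0; rewrite -mulrDr mulrC ler_wpM2r//.
  set s := (c.2^-1)%g.
  suff : f s / h s + g s / h s <= 1 by lra.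
  rewrite -mulrDl; have [h0|h0] := eqVneq (h s) 0.
    by rewrite h0 invr0 mulr0 ler01.
  have hs : 0 < h s by have [_ h_ge0] := Ch; rewrite lt_neqAle eq_sym h0 h_ge0.
  by rewrite ler_pdivrMr// mul1r lerDl mulr_ge0// ltW.
have e1 : cov f phi + cov g phi <= (1 + 2 * eta) * cov h phi.
  have p0 : 0 < 1 + 2 * eta by lra.
  by rewrite -ler_pdivrMl//; apply: cov_ge => // l /key; rewrite ler_pdivrMl.
have c0 : 0 < cov f0 phi by exact: cov_gt0.
have Cchi' : Ccp chi by [].
have e2 : cov h phi <= cov (fun x => f x + g x) phi + delta * cov chi phi.
  by rewrite -covZ//; apply: covD_le => //; apply: CcpZ => //; exact: ltW.
have e3 := ncov_le Cchi' pp; have e4 := ncov_le Cfg pp.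
have e5 : ncov f phi + ncov g phi <=
  (1 + 2 * eta) * (ncov (fun x => f x + g x) phi + delta * ncov chi phi).
  rewrite /ncov -mulrDl ler_pdivrMr//.
  set u := cov (fun x => f x + g x) phi in e2 *; set v := cov chi phi in e2 *.
  have -> : (1 + 2 * eta) * (u / cov f0 phi + delta * (v / cov f0 phi)) * cov f0 phi =
      (1 + 2 * eta) * (u + delta * v) by field; rewrite gt_eqF.
  by rewrite (le_trans e1)// ler_wpM2l//; lra.
apply: (le_trans e5).
have i0 := ncov_ge0 Cchi' pp; have j0 := ncov_ge0 Cfg pp.
have : delta * ncov chi phi <= e / 4.
  by apply: le_trans deltaB; rewrite ler_wpM2l// ltW.
have : 0 <= delta * ncov chi phi by rewrite mulr_ge0// ltW.
have : eta * ncov (fun x => f x + g x) phi <= e / 4.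
  by apply: le_trans etaA; rewrite ler_wpM2l// ltW.
move: (ncov (fun x => f x + g x) phi) (delta * ncov chi phi) => a b h1 h2 h3.
have : 2 * eta * b <= b by rewrite ler_piMl//; lra.
lra.
Qed.

(** The filter of bumps shrinking to 1; the bumps available in each neighbourhood of 1 make it
    proper. *)
Let F : set_system (G -> R) := filter_from (nbhs (1%g : G))
  (fun V => [set phi | posf phi /\ forall x, phi x != 0 -> V x]).

Lemma F_proper : ProperFilter F.
Proof.
apply: filter_from_proper.
  apply: filter_from_filter; first by exists setT; exact: filterT.
  move=> V W nV nW; exists (V `&` W); first exact: filterI.
  by move=> phi [pp h]; split; split=> // x /h [].
move=> V /bG[phi [cphi phi0 p1] [K [cK KV] phiK]].
exists phi; split=> [|x px]; first by split; [split=> //; split=> //;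
  exists K|exists 1%g].
by apply: KV; apply: contrapT => /phiK /eqP; rewrite (negbTE px).
Qed.

Theorem haar_functional : exists J : (G -> R) -> R,
  [/\ forall a f g, Cc f -> Cc g -> J (fun x => a * f x + g x) = a * J f + J g,
      forall f, Cc f -> (forall x, 0 <= f x) -> 0 <= J f,
      forall f s, Cc f -> J (fun x => f (x * s)%g) = J f &
      forall f, Cc f -> (forall x, 0 <= f x) -> (exists p, 0 < f p) -> 0 < J f].
Proof.
have [U [UU FU]] := ultraFilterLemma F_proper.
have PU : ProperFilter U by exact: ultra_proper.
have U_pos : \forall phi \near U, posf phi.
  by apply: FU; exists setT; [exact: filterT|move=> phi []].
pose L f := lim (ncov f phi @[phi --> U]).
(* The values stay in a compact interval, and a cluster point along an ultrafilter is a limit. A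
   single [U] thus serves all [f] at once. *)
have cvg_ncov f : Ccp f -> cvg (ncov f phi @[phi --> U]).
  move=> Cf.
  have [|l [_ Il]] := @segment_compact R 0 (cov f f0) (ncov f phi @[phi --> U]) _.
    apply: filterS U_pos => phi pp.
    by rewrite /= in_itv /= ncov_ge0//= ncov_le.
  apply/cvg_ex; exists l => A nA.
  have [//|UA] := in_ultra_setVsetC (ncov f @^-1` A) UU.
  by have [y [nAy /nAy]] := Il (~` A) A UA nA.
have lim_le (u v : (G -> R) -> R) : cvg (u phi @[phi --> U]) ->
    cvg (v phi @[phi --> U]) -> (\forall phi \near U, u phi <= v phi) ->
    lim (u phi @[phi --> U]) <= lim (v phi @[phi --> U]).
  move=> cu cv uv; rewrite -subr_ge0 -(@limB _ _ _ _ _ v u)//.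
  apply: limr_ge; first exact: is_cvgB.
  by apply: filterS uv => phi; rewrite subr_ge0.
have lim_pos_eq (u v : (G -> R) -> R) : cvg (u phi @[phi --> U]) ->
    cvg (v phi @[phi --> U]) -> (forall phi, posf phi -> u phi = v phi) ->
    lim (u phi @[phi --> U]) = lim (v phi @[phi --> U]).
  move=> cu cv uv; apply/eqP; rewrite eq_le; apply/andP; split; apply: lim_le => //;
    by apply: filterS U_pos => phi /uv ->.
have L_ge0 f : Ccp f -> 0 <= L f.
  move=> Cf; apply: limr_ge; first exact: cvg_ncov.
  by apply: filterS U_pos => phi; exact: ncov_ge0.
(* The lower bound [(cov f0 f)^-1] does not depend on [phi], so strict positivity survives the
   limit. *)
have L_gt0 f : posf f -> 0 < L f.
  move=> pf; apply: (@lt_le_trans _ _ (cov f0 f)^-1); first by rewrite invr_gt0 cov_gt0.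
  apply: limr_ge; first by apply: cvg_ncov; case: pf.
  by apply: filterS U_pos => phi; exact: ncov_ge.
have L_mulr f s : Ccp f -> L (fun x => f (x * s)%g) = L f.
  move=> Cf; have Cfs := Ccp_right_mul s Cf.
  by apply: lim_pos_eq => [||phi pp];
    [exact: cvg_ncov|exact: cvg_ncov|rewrite /ncov cov_right_mul].
have LZ0 a f : 0 < a -> Ccp f -> L (fun x => a * f x) = a * L f.
  move=> a0 Cf; have Caf := CcpZ (ltW a0) Cf.
  have cf := cvg_ncov _ Cf.
  have -> : a * L f = lim (a * ncov f phi @[phi --> U]).
    rewrite (@limM _ _ _ _ (cst a) (ncov f))//; last exact: is_cvg_cst.
    by rewrite lim_cst.
  apply: lim_pos_eq => [||phi pp]; first exact: cvg_ncov.
    by apply: (@is_cvgM _ _ _ _ (cst a) (ncov f)) => //; exact: is_cvg_cst.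
  by rewrite /ncov covZ// mulrA.
have LD f g : Ccp f -> Ccp g -> L (fun x => f x + g x) = L f + L g.
  move=> Cf Cg; have Cfg := CcpD Cf Cg.
  have cs : cvg (ncov f phi + ncov g phi @[phi -->
    U]) by apply: (@is_cvgD _ _ _ _ _ (ncov f) (ncov g)); exact: cvg_ncov.
  have ls : lim (ncov f phi + ncov g phi @[phi --> U]) = L f + L g.
    by apply: (@limD _ _ _ _ _ (ncov f) (ncov g)); exact: cvg_ncov.
  apply/eqP; rewrite eq_le -ls; apply/andP; split.
    apply: lim_le => //; first exact: cvg_ncov.
    apply: filterS U_pos => phi pp; rewrite /ncov -mulrDl ler_wpM2r//.
      by rewrite invr_ge0 ltW// cov_gt0.
    exact: covD_le.
  (* How small [phi] must be depends on [e]; superadditivity therefore holds up to each [e]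
     eventually along [U], and exactly in the limit. *)
  apply/ler_addgt0Pr => e e0.
  have ce : cvg (ncov (fun x => f x + g x) phi + e @[phi --> U]).
    by apply: (@is_cvgD _ _ _ _ _ (ncov _) (cst e));
      [exact: cvg_ncov|exact: is_cvg_cst].
  have -> : L (fun x => f x + g x) + e =
    lim (ncov (fun x => f x + g x) phi + e @[phi --> U]).
    rewrite (@limD _ _ _ _ _ (ncov _) (cst e)); [|exact: cvg_ncov|exact: is_cvg_cst].
    by rewrite lim_cst.
  apply: lim_le => //.
  have [V nV VI] := ncov_almost_superadditive Cf Cg e0.
  by apply: FU; exists V => // phi [pp phiV]; exact: VI.
have L0 : L (fun=> 0) = 0.
  have C0 : Ccp (fun=> 0) by split=> //; exact: Cc0.
  have := LD _ _ C0 C0; rewrite addr0 => /eqP;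
    rewrite -subr_eq0 opprD addrA subrr add0r.
  by rewrite oppr_eq0 => /eqP.
have LZ a f : 0 <= a -> Ccp f -> L (fun x => a * f x) = a * L f.
  rewrite le_eqVlt => /orP[/eqP <- _|]; last exact: LZ0.
  by rewrite mul0r -[RHS]L0; congr L; apply/funext => x; rewrite mul0r.
have [pp [pn [Cpp Cpn pE]]] : exists pp pn : (G -> R) -> G -> R,
    [/\ forall f, Cc f -> Ccp (pp f), forall f, Cc f -> Ccp (pn f) &
        forall f x, pp f x - pn f x = f x].
  pose pp f x : R := 2^-1 * (`|f x| + f x); pose pn f x : R := 2^-1 * (`|f x| - f x).
  have Cabs f : Cc f -> Cc (fun x => `|f x|).
    move=> [cf [K cK fK]]; split; first by move=> x; apply: cvg_norm; exact: cf.
    by exists K => // x /fK ->; rewrite normr0.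
  have Cpp f : Cc f -> Ccp (pp f).
    move=> Cf; split; first by apply: CcZ; apply: CcD => //; exact: Cabs.
    by move=> x; rewrite mulr_ge0// -lerBlDr sub0r -normrN ler_norm.
  have Cpn f : Cc f -> Ccp (pn f).
    move=> Cf; split.
      apply: CcZ; have := Cc_lin (-1) Cf (Cabs _ Cf); congr Cc.
      by apply/funext => x; rewrite mulN1r addrC.
    by move=> x; rewrite mulr_ge0// subr_ge0 ler_norm.
  have pE f x : pp f x - pn f x = f x by rewrite /pp /pn; lra.
  by exists pp, pn.
pose J f := L (pp f) - L (pn f).
(* [L] is additive on nonnegative functions only. The extension to differences does not depend on
   the decomposition chosen, which yields linearity and invariance at once. *)
have JE f a b : Cc f -> Ccp a -> Ccp b -> (forall x, f x = a x - b x) ->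
    J f = L a - L b.
  move=> Cf Ca Cb fE.
  have : L (fun x => pp f x + b x) = L (fun x => a x + pn f x).
    by congr L; apply/funext => x; have := pE f x; have := fE x; lra.
  by rewrite !LD//; do ?[exact: Cpp|exact: Cpn]; rewrite /J; lra.
exists J; split.
- move=> a f g Cf Cg.
  have [a0|a0] := leP 0 a.
    rewrite (@JE _ (fun x => a * pp f x + pp g x) (fun x => a * pn f x + pn g x)).
    + rewrite !LD ?LZ//; do ?[exact: Cpp|exact: Cpn|by apply: CcpZ => //;
      [exact: Cpp]|by apply: CcpZ => //; [exact: Cpn]].
      by rewrite /J; ring.
    + exact: Cc_lin.
    + by apply: CcpD; [apply: CcpZ => //|]; exact: Cpp.
    + by apply: CcpD; [apply: CcpZ => //|]; exact: Cpn.
    + by move=> x; rewrite -{1}(pE f) -{1}(pE g); ring.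
  (* A negative factor exchanges the positive and the negative parts. *)
  have a0' : 0 <= - a by rewrite oppr_ge0 ltW.
  rewrite (@JE _ (fun x => - a * pn f x + pp g x) (fun x => - a * pp f x + pn g x)).
  + rewrite !LD ?LZ//; do ?[exact: Cpp|exact: Cpn|by apply: CcpZ => //;
    [exact: Cpp]|by apply: CcpZ => //; [exact: Cpn]].
    by rewrite /J; ring.
  + exact: Cc_lin.
  + by apply: CcpD; [apply: CcpZ => //; exact: Cpn|exact: Cpp].
  + by apply: CcpD; [apply: CcpZ => //; exact: Cpp|exact: Cpn].
  + by move=> x; rewrite -{1}(pE f) -{1}(pE g); ring.
- move=> f Cf fge0; rewrite (@JE _ f (fun=> 0))//.
  + by rewrite L0 subr0 L_ge0.
  + by split=> //; exact: Cc0.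
  + by move=> x; rewrite subr0.
- move=> f s Cf; rewrite (@JE _ (fun x => pp f (x * s)%g) (fun x => pn f (x * s)%g)).
  + by rewrite !L_mulr//; [exact: Cpn|exact: Cpp].
  + exact: Cc_right_mul.
  + by apply: Ccp_right_mul; exact: Cpp.
  + by apply: Ccp_right_mul; exact: Cpn.
  + by move=> x; rewrite pE.
- move=> f Cf fge0 pf; rewrite (@JE _ f (fun=> 0))//.
  + by rewrite L0 subr0 L_gt0.
  + by split=> //; exact: Cc0.
  + by move=> x; rewrite subr0.
Qed.

End haar.


(** * Smooth functions depending on a parameter *)

Section chain_rule.
Variables (R : realType) (V : normedModType R).
Implicit Types (f : V -> R^o) (x v : V).

Lemma is_derive_line f x v (t : R) : derivable f (t *: v + x) v ->
  is_derive t 1 (fun s : R => f (s *: v + x)) ('D_v f (t *: v + x)).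
Proof.
have E : (fun h : R => h^-1 *: (((fun s : R => f (s *: v + x)) \o shift t) (h *:
  1) - f (t *: v + x))) =
    (fun h : R => h^-1 *: ((f \o shift (t *: v + x)) (h *: v) - f (t *: v + x))).
  by apply/funext => h /=; rewrite /shift/= scalerDl [h *: 1]mulr1 addrA.
by move=> df; apply: DeriveDef; [rewrite /derivable E|rewrite /derive E].
Qed.

(** The mean value theorem on the segment from [x] to [h *: v + x]. The sign of [h] is free, hence
    the two orientations in the proof. *)
Lemma increment_bound f x v (h d e : R) :
  (forall t : R, `|t| <= `|h| -> derivable f (t *: v + x) v) ->
  (forall t : R, `|t| <= `|h| -> `|'D_v f (t *: v + x) - d| <= e) ->
  `|f (h *: v + x) - f x - h * d| <= e * `|h|.
Proof.
move=> df De; pose phi (t : R) : R := f (t *: v + x).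
have dphi (t : R) : `|t| <= `|h| -> is_derive t 1 phi ('D_v f (t *: v + x)).
  by move=> th; exact: is_derive_line (df t th).
have cphi (t : R) : `|t| <= `|h| -> {for t, continuous phi}.
  move=> th; apply: differentiable_continuous; apply/derivable1_diffP.
  by have [] := dphi t th.
have [c ch E] : exists2 c, `|c| <= `|h| &
    phi h - phi 0 = 'D_v f (c *: v + x) * h.
  have [h0|h0] := leP 0 h.
    have [||c] := @MVT_segment R phi (fun t => 'D_v f (t *: v + x)) 0 h h0.
    + move=> t; rewrite in_itv /= => /andP[t0 th].
      by apply: dphi; rewrite !ger0_norm// ltW.
    + apply: continuous_in_subspaceT => t; rewrite inE /= in_itv /= => /andP[t0 th].
      by apply: cphi; rewrite !ger0_norm.
    rewrite in_itv /= subr0 => /andP[c0 ch] E; exists c => //.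
    by rewrite !ger0_norm.
  have [||c] := @MVT_segment R phi (fun t => 'D_v f (t *: v + x)) h 0 (ltW h0).
  + move=> t; rewrite in_itv /= => /andP[t0 th].
    by apply: dphi; rewrite !ler0_norm ?lerN2// ltW.
  + apply: continuous_in_subspaceT => t; rewrite inE /= in_itv /= => /andP[t0 th].
    by apply: cphi; rewrite !ler0_norm ?lerN2// ltW.
  rewrite in_itv /= sub0r => /andP[c0 ch] E; exists c.
    by rewrite !ler0_norm ?lerN2// ltW.
  by rewrite -opprB E mulrN opprK.
have phi0 : phi 0 = f x by rewrite /phi scale0r add0r.
have -> : f (h *: v + x) = phi h by [].
rewrite -phi0 E -mulrC -mulrBr normrM mulrC ler_wpM2r//.
exact: De.
Qed.

(* Mean value inequality along the axes, one coordinate at a time: continuous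
   partial derivatives give a first-order expansion. *)
Lemma multi_increment_bound m (b : 'I_m -> V) f (U : set V) x (e : R) :
  (forall i y, U y -> derivable f y (b i)) ->
  (forall i, {for x, continuous (fun y => 'D_(b i) f y : R^o)}) ->
  nbhs x U -> 0 < e ->
  nbhs (0 : 'rV[R]_m) [set z : 'rV[R]_m |
    `|f (\sum_i z 0 i *: b i + x) - f x - \sum_i z 0 i * 'D_(b i) f x| <= e * `|z|].
Proof.
move=> df cf nU e0.
(* Each of the [m] coordinate increments costs at most [eps * |z|]; the added 1 also covers
   [m = 0]. *)
pose eps := e / (m%:R + 1).
have m1 : 0 < m%:R + 1 :> R by rewrite ltr_wpDl.
have eps0 : 0 < eps by rewrite divr_gt0.
have : \forall y \near x, U y /\ forall i, `|'D_(b i) f y - 'D_(b i) f x| <= eps.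
  apply: filterI => //; apply: filter_forall => i.
  have /cvgrPdist_le/(_ _ eps0) := cf i.
  by apply: filterS => y; rewrite distrC.
move=> /nbhs_ballP[r /= r0 rU].
pose C := \sum_i `|b i|.
have C0 : 0 <= C by exact: sumr_ge0.
have mC : 0 < (m%:R + 1) * (C + 1) by rewrite mulr_gt0// ltr_wpDl.
(* Every intermediate point of the path along the axes is within [(m + 1) * (C + 1) * |z|] of [x],
   so this radius keeps the path in the ball where the estimates hold. *)
apply/nbhs_ballP; exists (r / ((m%:R + 1) * (C + 1))); first by rewrite /= divr_gt0.
move=> z; rewrite -ball_normE /= sub0r normrN => zr.
have zi i : `|z 0 i| <= `|z|.
  rewrite [leRHS]/Num.Def.normr/= mx_normrE.
  exact: (le_bigmax _ (fun i => `|z i.1 i.2|) (0, i)).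
have bC i : `|b i| <= C.
  by rewrite /C (bigD1 i)//= lerDl sumr_ge0.
have key (s : seq 'I_m) : (size s <= m)%N ->
    `|\sum_(i <- s) z 0 i *: b i| <= (size s)%:R * (C * `|z|) /\
    `|f (\sum_(i <- s) z 0 i *: b i + x) - f x - \sum_(i <- s) z 0 i * 'D_(b i) f x|
      <= (size s)%:R * (eps * `|z|).
  elim: s => [|i s IH] /= sm.
    by rewrite !big_nil add0r !subrr !normr0 !mul0r.
  have [IH1 IH2] := IH (ltnW sm).
  rewrite !big_cons; split.
    rewrite -natr1 mulrDl mul1r addrC (le_trans (ler_normD _ _))// lerD//.
    by rewrite normrZ mulrC ler_pM.
  set w := \sum_(i <- s) z 0 i *: b i in IH1 IH2 *.
  have Hw t : `|t| <= `|z 0 i| -> `|t *: b i + w| < r.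
    move=> tz; apply: (@le_lt_trans _ _ ((m%:R + 1) * (C + 1) * `|z|)); last first.
      by rewrite mulrC -ltr_pdivlMr.
    apply: (le_trans (ler_normD _ _)).
    apply: (@le_trans _ _ (C * `|z| + m%:R * (C * `|z|))).
      apply: lerD.
        by rewrite normrZ mulrC ler_pM// (le_trans tz).
      apply: (le_trans IH1); rewrite ler_wpM2r ?mulr_ge0//.
      by rewrite ler_nat ltnW.
    have -> : C * `|z| + m%:R * (C * `|z|) = (m%:R + 1) * C * `|z| by ring.
    by rewrite ler_wpM2r// ler_wpM2l ?lerDl// ltW.
  have HU t : `|t| <= `|z 0 i| -> ball x r (t *: b i + (w + x)).
    by move=> /Hw; rewrite -ball_normE /= distrC addrA addrK.
  have := @increment_bound f (w + x) (b i) (z 0 i) ('D_(b i) f x) eps.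
  move=> /(_ (fun t tz => df i _ (rU _ (HU t tz)).1)).
  move=> /(_ (fun t tz => (rU _ (HU t tz)).2 i)) => M.
  rewrite -[_ *: _ + w + x]addrA.
  have -> : f (z 0 i *: b i + (w + x)) - f x -
      (z 0 i * 'D_(b i) f x + \sum_(j <- s) z 0 j * 'D_(b j) f x) =
    (f (z 0 i *: b i + (w + x)) - f (w + x) - z 0 i * 'D_(b i) f x) +
    (f (w + x) - f x - \sum_(j <- s) z 0 j * 'D_(b j) f x) by lra.
  rewrite -natr1 mulrDl mul1r addrC (le_trans (ler_normD _ _))// lerD//.
  by rewrite (le_trans M)// ler_wpM2l// ltW.
have sm : size (index_enum 'I_m) = m.
  by rewrite [index_enum _]unlock -enumT size_enum_ord.
have [_] := key (index_enum 'I_m) (eq_leq sm).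
rewrite sm => /le_trans; apply.
rewrite mulrA ler_wpM2r// /eps mulrCA ler_piMr ?ltW//.
by rewrite ltr_pdivrMr// mul1r ltrDl.
Qed.

End chain_rule.

Section derive_chain.
Variables (R : realType) (V : normedModType R).

Lemma rV_sum_delta m (z : 'rV[R]_m) : z = \sum_i z 0 i *: delta_mx 0 i.
Proof.
apply/rowP => j; rewrite summxE (bigD1 j)//= big1 ?addr0.
  by rewrite !mxE !eqxx mulr1.
by move=> i ij; rewrite !mxE eqxx (negbTE (_ : j != i)) ?mulr0// eq_sym.
Qed.

Lemma cvg_row m (T : Type) (F : set_system T) (r : T -> 'rV[R]_m) (l : 'rV[R]_m) :
  Filter F -> (forall i, (fun t => r t 0 i) @ F --> l 0 i) -> r @ F --> l.
Proof.
move=> FF cr; apply/cvgrPdist_le => e e0; near=> h.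
rewrite [leLHS]/Num.Def.normr/= mx_normrE (bigmax_le _ (ltW e0))//= => -[i j] _.
rewrite !ord1 mxE [X in _ + X]mxE/=.
move: j {i}; near: h; apply: filter_forall => j.
by have /cvgrPdist_le/(_ _ e0) := cr j.
Unshelve. all: by end_near. Qed.

(** Smoothness is expressed by directional derivatives, so the outer function is known through its
    continuous partial derivatives, and [multi_increment_bound] supplies its linear approximation.
    The inner function needs a derivative along [v] only. *)
Lemma derive_chain m (b : 'rV[R]_m -> R^o) (U : set 'rV[R]_m) (r : V -> 'rV[R]_m) y v :
  (forall i z, U z -> derivable b z (delta_mx 0 i)) ->
  (forall i, {for r y, continuous (fun z => 'D_(delta_mx 0 i) b z : R^o)}) ->
  nbhs (r y) U ->
  (forall i, derivable (fun z => r z 0 i : R^o) y v) ->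
  is_derive y v (b \o r : V -> R^o)
    (\sum_i 'D_v (fun z => r z 0 i : R^o) y * 'D_(delta_mx 0 i) b (r y)).
Proof.
move=> db cb nU dr.
set g := \sum_i _.
suff : (fun h : R => h^-1 *: ((b \o r) (h *: v + y) - (b \o r) y)) @ 0^' --> g.
  by move=> cg; apply: DeriveDef; [apply/cvg_ex; exists g|exact: cvg_lim].
pose z (h : R) := r (h *: v + y) - r y.
pose q (h : R) := h^-1 *: z h.
have qE h i : q h 0 i = h^-1 *: ((r (h *: v + y) 0 i : R^o) - r y 0 i).
  by rewrite !mxE.
have cq i : (fun h => q h 0 i) @ 0^' --> ('D_v (fun z => r z 0 i : R^o) y).
  by under eq_fun do rewrite qE; exact: dr.
have cqq : q @ 0^' --> \row_i 'D_v (fun z => r z 0 i : R^o) y.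
  by apply: cvg_row => i; rewrite mxE.
have cz : z @ 0^' --> (0 : 'rV[R]_m).
  have : (fun h => h *: q h) @ 0^' -->
    (0 : R) *: \row_i 'D_v (fun z => r z 0 i : R^o) y.
    by apply: cvgZ => //; apply: cvg_within_filter; exact: cvg_id.
  rewrite scale0r; apply: cvg_trans; apply: near_eq_cvg.
  near=> h; rewrite /q scalerA divff ?scale1r//.
  by near: h; exact: nbhs_dnbhs_neq.
(* [Q] bounds the difference quotients [q h] for small [h]; an error [e / 2 / Q * |z h|] then
   contributes at most [e / 2] after division by [h]. *)
pose Q := `|\row_i 'D_v (fun z => r z 0 i : R^o) y| + 1.
have Q0 : 0 < Q by rewrite ltr_wpDl.
have c1 : (fun h => \sum_i q h 0 i * 'D_(delta_mx 0 i) b (r y)) @ 0^' --> g.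
  by apply: cvg_big => [|i _]; [exact: add_continuous|apply: cvgM;
    [exact: cq|exact: cvg_cst]].
apply/cvgrPdist_le => e e0.
have e2 : 0 < e / 2 by rewrite divr_gt0.
have eQ : 0 < e / 2 / Q by rewrite divr_gt0.
have Bd := multi_increment_bound db cb nU eQ.
near=> h.
have h0 : h != 0 by near: h; exact: nbhs_dnbhs_neq.
have E : h^-1 *: ((b \o r) (h *: v + y) - (b \o r) y) -
    \sum_i q h 0 i * 'D_(delta_mx 0 i) b (r y) =
    h^-1 * (b (\sum_i z h 0 i *: delta_mx 0 i + r y) - b (r y) -
      \sum_i z h 0 i * 'D_(delta_mx 0 i) b (r y)).
  rewrite -rV_sum_delta subrK [in RHS]mulrBr mulr_sumr; congr (_ - _).
  by apply: eq_bigr => i _; rewrite mulrA /q mxE.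
rewrite distrC -[X in `|X|](subrKA (\sum_i q h 0 i * 'D_(delta_mx 0 i) b (r y))).
rewrite (splitr e) (le_trans (ler_normD _ _))// lerD//.
  rewrite E normrM.
  apply: (@le_trans _ _ (`|h^-1| * (e / 2 / Q * `|z h|))).
    rewrite ler_wpM2l//.
    by near: h; exact: (cz _ Bd).
  rewrite mulrCA -normrZ -/(q h).
  rewrite mulrAC ler_pdivrMr// ler_pM2l//.
  near: h.
  have /cvgrPdist_le/(_ _ ltr01) := cqq; apply: filterS => h.
  rewrite -[q h in X in _ -> X](subKr (\row_i 'D_v (fun z => r z 0 i : R^o) y)) => qh.
  by rewrite (le_trans (ler_normB _ _))// lerD2l.
rewrite distrC; near: h; by have /cvgrPdist_le/(_ _ e2) := c1.
Unshelve. all: by end_near. Qed.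

End derive_chain.

Section param_smooth.
Variable R : realType.
Implicit Types (X : topologicalType) (V : normedModType R).

Definition pderive X V (v : V) (f : X * V -> R^o) : X * V -> R^o :=
  fun p => 'D_v (fun y => f (p.1, y)) p.2.

Definition pderivable X V (v : V) (f : X * V -> R^o) (p : X * V) : Prop :=
  derivable (fun y => f (p.1, y)) p.2 v.

(* f is k times differentiable in its second variable, each derivative being
   continuous in both variables. [Ck_on U k f] is the case where f does not depend
   on the parameter; see [PCk_of_Ck] and [Ck_of_PCk]. *)
Fixpoint PCk X V (O : set (X * V)) (k : nat) (f : X * V -> R^o) : Prop :=
  (forall p, O p -> {for p, continuous f}) /\
  match k with
  | 0 => True
  | k'.+1 => forall v, (forall p, O p -> pderivable v f p) /\
                       PCk O k' (pderive v f)
  end.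

Lemma PCk_cont X V (O : set (X * V)) k f p : PCk O k f -> O p -> {for p, continuous f}.
Proof. by case: k => [|k] [+ _]; apply. Qed.

Lemma PCkW X V (O : set (X * V)) k f : PCk O k.+1 f -> PCk O k f.
Proof.
elim: k f => [|k IH] f [cf df]; first by split.
by split=> // v; have [? /IH] := df v.
Qed.

Lemma PCk_sub X V (O O' : set (X * V)) k f : O' `<=` O -> PCk O k f -> PCk O' k f.
Proof.
move=> OO; elim: k f => [|k IH] f [cf df]; first by split=> // p /OO/cf.
split=> [p /OO/cf|v] //; have [dv /IH] := df v; by split=> // p /OO/dv.
Qed.

(** Each clause of [PCk] is a condition at a point [p], formulated with full neighbourhoods in the
    ambient space, so it may be checked point by point. *)
Lemma PCk_local X V (O : set (X * V)) k f :
  (forall p, O p -> exists2 O', O' p & PCk O' k f) -> PCk O k f.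
Proof.
elim: k f => [|k IH] f loc.
  by split=> // p /loc[W Wp [h _]]; exact: h.
split=> [p /loc[W Wp [h _]]|v]; first exact: h.
split=> [p /loc[W Wp [_ /(_ v)[h _]]]|]; first exact: h.
by apply: IH => p /loc[W Wp [_ /(_ v)[_ ?]]]; exists W.
Qed.

Lemma pairr_continuous (T U : topologicalType) (x : T) :
  continuous (fun z : U => (x, z)).
Proof. by move=> z; apply: cvg_pair; [exact: cvg_cst|exact: cvg_id]. Qed.

Lemma open_slice X V (O : set (X * V)) p : open O -> O p ->
  nbhs p.2 [set y | O (p.1, y)].
Proof.
move=> oO Op; have nO : nbhs (p.1, p.2) O by rewrite -surjective_pairing;
  exact: open_nbhs_nbhs.
exact: (@pairr_continuous X V p.1).
Qed.

Lemma near_eq_continuous (T U : topologicalType) (f g : T -> U) t :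
  {near t, f =1 g} -> {for t, continuous f} -> {for t, continuous g}.
Proof.
move=> fg cf; rewrite /prop_for /continuous_at -(nbhs_singleton fg).
by apply: cvg_trans cf; apply: near_eq_cvg.
Qed.

Lemma PCk_eq X V (O : set (X * V)) k f g : open O -> (forall p, O p -> f p = g p) ->
  PCk O k f -> PCk O k g.
Proof.
move=> oO; elim: k f g => [|k IH] f g fg [cf df];
  have fgO p : O p -> {near p, f =1 g}.
- by move=> Op; have : nbhs p O by [exact: open_nbhs_nbhs]; apply: filterS => q /fg.
- by split=> // p Op; apply: near_eq_continuous (cf p Op); exact: fgO.
- by move=> Op; have : nbhs p O by [exact: open_nbhs_nbhs]; apply: filterS => q /fg.
have nfg p : O p -> \forall y \near p.2, f (p.1, y) = g (p.1, y).
  by move=> Op; have := open_slice oO Op; apply: filterS => y /fg.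
split=> [p Op|v]; first by apply: near_eq_continuous (cf p Op); exact: fgO.
have [dv Cv] := df v; split=> [p Op|].
  by apply: near_eq_derivable (dv p Op); exact: nfg.
apply: IH Cv => p Op; apply: near_eq_derive; exact: nfg.
Qed.

Lemma PCk_cst X V (O : set (X * V)) k (c : R) : PCk O k (fun=> c).
Proof.
elim: k c => [|k IH] c; first by split=> // p _; exact: cvg_cst.
split=> [p _|v]; first exact: cvg_cst.
split=> [p _|]; first exact: derivable_cst.
have -> : pderive v (fun _ : X * V => c) = (fun=> 0); last exact: IH.
by apply/funext => p; rewrite /pderive derive_cst.
Qed.

Lemma PCkD X V (O : set (X * V)) k f g : open O -> PCk O k f -> PCk O k g ->
  PCk O k (fun p => f p + g p).
Proof.
move=> oO; elim: k f g => [|k IH] f g [cf df] [cg dg].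
  by split=> // p Op; apply: cvgD; [exact: cf|exact: cg].
split=> [p Op|v]; first by apply: cvgD; [exact: cf|exact: cg].
have [dfv Cf] := df v; have [dgv Cg] := dg v; split=> [p Op|].
  by apply: derivableD; [exact: dfv|exact: dgv].
apply: PCk_eq (IH _ _ Cf Cg) => // -[x y] Oxy.
by rewrite /pderive (deriveD (dfv _ Oxy) (dgv _ Oxy)).
Qed.

Lemma PCkM X V (O : set (X * V)) k f g : open O -> PCk O k f -> PCk O k g ->
  PCk O k (fun p => f p * g p).
Proof.
move=> oO; elim: k f g => [|k IH] f g.
  by move=> [cf df] [cg dg]; split=> // p Op; apply: cvgM; [exact: cf|exact: cg].
move=> Cf Cg; have [cf df] := Cf; have [cg dg] := Cg.
split=> [p Op|v]; first by apply: cvgM; [exact: cf|exact: cg].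
have [dfv Cfv] := df v; have [dgv Cgv] := dg v; split=> [p Op|].
  by apply: derivableM; [exact: dfv|exact: dgv].
apply: PCk_eq (PCkD oO (IH _ _ (PCkW Cf) Cgv) (IH _ _ (PCkW Cg) Cfv)) => // -[x y] Oxy.
by rewrite /pderive (deriveM (dfv _ Oxy) (dgv _ Oxy)).
Qed.

Lemma PCk_sum X V (O : set (X * V)) k (I : Type) (s : seq I) (f : I -> X * V -> R^o) :
  open O -> (forall i, PCk O k (f i)) -> PCk O k (fun p => \sum_(i <- s) f i p).
Proof.
move=> oO Cf; elim: s => [|i s IH].
  have -> : (fun p => \sum_(i <- [::]) f i p) = (fun=> 0).
    by apply/funext => p; rewrite big_nil.
  exact: PCk_cst.
have -> : (fun p => \sum_(i <- i :: s) f i p) = (fun p => f i p + \sum_(i <- s) f i p).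
  by apply/funext => p; rewrite big_cons.
exact: PCkD.
Qed.

Lemma PCk_prod X V (O : set (X * V)) k (I : Type) (s : seq I) (f : I -> X * V -> R^o) :
  open O -> (forall i, PCk O k (f i)) -> PCk O k (fun p => \prod_(i <- s) f i p).
Proof.
move=> oO Cf; elim: s => [|i s IH].
  have -> : (fun p => \prod_(i <- [::]) f i p) = (fun=> 1).
    by apply/funext => p; rewrite big_nil.
  exact: PCk_cst.
have -> : (fun p => \prod_(i <- i ::
  s) f i p) = (fun p => f i p * \prod_(i <- s) f i p).
  by apply/funext => p; rewrite big_cons.
exact: PCkM.
Qed.

(** The derivatives never touch the first variable, so a merely continuous change of parameter is
    allowed. It lets a chart of the group be inserted later. *)
Lemma PCk_pull X X' V (O : set (X * V)) (O' : set (X' * V)) k f (phi : X' -> X) :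
  (forall p, O' p -> {for p.1, continuous phi} /\ O (phi p.1, p.2)) ->
  PCk O k f -> PCk O' k (fun p => f (phi p.1, p.2)).
Proof.
move=> OO; elim: k f => [|k IH] f [cf df].
  split=> // p /OO[cphi Op].
  apply: (@continuous_comp _ _ _ (fun p : X' * V => (phi p.1, p.2)) f); last exact: cf.
  apply: cvg_pair; last exact: cvg_snd.
  by apply: (@continuous_comp _ _ _ fst phi) => //; exact: cvg_fst.
split=> [p /OO[cphi Op]|v].
  apply: (@continuous_comp _ _ _ (fun p : X' * V => (phi p.1, p.2)) f); last exact: cf.
  apply: cvg_pair; last exact: cvg_snd.
  by apply: (@continuous_comp _ _ _ fst phi) => //; exact: cvg_fst.
have [dv Cv] := df v; split=> [p /OO[_ /dv //]|].
exact: IH Cv.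
Qed.

(** By the chain rule a derivative is a sum of products of a derivative of [r] and a partial
    derivative of [b] along [r], one order lower. Writing the outer function as [b \o snd] makes its
    partial derivatives again of the form required by the induction. *)
Lemma PCk_comp X V m (O : set (X * V)) (U : set 'rV[R]_m) k (b : 'rV[R]_m -> R^o)
    (r : X * V -> 'rV[R]_m) :
  open O -> open U -> (forall p, O p -> U (r p)) ->
    PCk (X := X) (snd @^-1` U) k (b \o snd) ->
  (forall i, PCk O k (fun p => r p 0 i)) -> PCk O k (b \o r).
Proof.
move=> oO oU OU.
have rcont j : (forall i, PCk O j (fun p => r p 0 i)) -> forall p, O p ->
  {for p, continuous r}.
  by move=> Cr p Op; apply: cvg_row => i; exact: (PCk_cont (Cr i) Op).
have bcont j (b' : 'rV[R]_m -> R^o) (x : X) z : U z ->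
    PCk (X := X) (snd @^-1` U) j (b' \o snd) -> {for z, continuous b'}.
  move=> Uz Cb; have c := PCk_cont (p := (x, z)) Cb Uz.
  apply: (@continuous_comp _ _ _ (fun z => (x, z)) (b' \o snd)) => //.
  exact: pairr_continuous.
elim: k b => [|k IH] b Cb Cr.
  split=> // p Op; apply: continuous_comp; first exact: (rcont 0).
  by apply: (bcont 0 b p.1) => //; exact: OU.
have [cb db] := Cb; split=> [p Op|v].
  apply: continuous_comp; first exact: (rcont k.+1).
  by apply: (bcont k.+1 b p.1) => //; exact: OU.
have ch p : O p -> is_derive p.2 v (fun y => (b \o r) (p.1, y) : R^o)
    (\sum_i pderive v (fun p => r p 0 i) p * 'D_(delta_mx 0 i) b (r p)).
  move=> Op; have rp : r (p.1, p.2) = r p by rewrite -surjective_pairing.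
  have := @derive_chain R V m b U (fun y => r (p.1, y)) p.2 v.
  rewrite /= rp; apply.
  - by move=> i z Uz; have [h _] := db (delta_mx 0 i); exact: (h (p.1, z)).
  - move=> i; have [_ Dk] := db (delta_mx 0 i).
    by apply: (bcont k _ p.1) => //; exact: OU.
  - by apply: open_nbhs_nbhs; split=> //; exact: OU.
  - by move=> i; have [_ /(_ v)[h _]] := Cr i; exact: h Op.
split=> [p /ch [] //|].
have oE p : O p -> \sum_i pderive v (fun p => r p 0 i) p * 'D_(delta_mx 0 i) b (r p) =
    pderive v (b \o r) p.
  by move=> /ch [_ <-].
apply: (PCk_eq oO oE); apply: PCk_sum => // i; apply: PCkM => //.
  by have [_ /(_ v)[]] := Cr i.
apply: (IH (fun z => 'D_(delta_mx 0 i) b z)) => [|j]; last exact: PCkW.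
by have [_] := db (delta_mx 0 i).
Qed.

Lemma Ck_on_dirderiv V (U : set V) k (f : V -> R^o) (v : V) :
  Ck_on (W := R^o) U k.+1 f -> exists2 g : V -> R^o,
    forall x, U x -> derivable f x v /\ 'D_v f x = g x & Ck_on (W := R^o) U k g.
Proof.
move=> [_ /(_ v)[g fg Cg]]; exists g => // x /fg c.
by split; [apply/cvg_ex; exists (g x)|exact: cvg_lim c].
Qed.

Lemma PCk_of_Ck X V (U : set V) k (f : V -> R^o) : open U ->
  Ck_on (W := R^o) U k f -> PCk (X := X) (snd @^-1` U) k (f \o snd).
Proof.
move=> oU; have oO : open (snd @^-1` U : set (X * V)).
  by apply: open_comp => // p _; exact: cvg_snd.
have cU j (g : V -> R^o) (p : X * V) : Ck_on (W := R^o) U j g -> U p.2 ->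
    {for p, continuous (g \o snd)}.
  case: j => [|j] [cg _] Up; (apply: continuous_comp; first exact: cvg_snd);
    by apply: cg; rewrite inE.
elim: k f => [|k IH] f Cf; first by split=> // p; exact: cU Cf.
split=> [p|v]; first exact: cU Cf.
have [g fg Cg] := Ck_on_dirderiv v Cf; split=> [p /fg[] //|].
by apply: PCk_eq (IH _ Cg) => // p /fg[].
Qed.

Lemma Ck_of_PCk X V (x : X) (U : set V) k (F : X * V -> R^o) :
  PCk (setT `*` U) k F -> Ck_on (W := R^o) U k (fun y => F (x, y)).
Proof.
have cU (G : X * V -> R^o) : (forall p, (setT `*` U) p -> {for p, continuous G}) ->
    {in U, continuous (fun y => G (x, y))}.
  move=> cG y; rewrite inE => Uy.
  apply: (@continuous_comp _ _ _ (fun y => (x, y)) G); last exact: cG.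
  exact: pairr_continuous.
elim: k F => [|k IH] F [cF dF]; split=> //; do ?exact: cU.
move=> v; have [dv Cv] := dF v; exists (fun y => pderive v F (x, y)); last exact: IH.
by move=> y Uy; exact: (dv (x, y)).
Qed.

(** A derivative along [v] in the second variable is the directional derivative along [(0, v)];
    those in the first variable are forgotten. *)
Lemma PCk_of_Ck_prod (V1 V2 : normedModType R) (O : set (V1 * V2)) k
    (f : V1 * V2 -> R^o) : open O ->
  Ck_on (W := R^o) O k f -> PCk O k f.
Proof.
move=> oO.
have cO j (g : V1 * V2 -> R^o) p : Ck_on (W := R^o) O j g -> O p ->
  {for p, continuous g}.
  by case: j => [|j] [cg _] Op; apply: cg; rewrite inE.
elim: k f => [|k IH] f Cf; first by split=> // p; exact: cO Cf.
split=> [p|v]; first exact: cO Cf.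
have [g fg Cg] := Ck_on_dirderiv (0, v) Cf.
have E p : (fun h : R => h^-1 *: (((fun y => f (p.1, y)) \o shift p.2) (h *:
  v) - f (p.1, p.2))) =
    (fun h : R => h^-1 *: ((f \o shift p) (h *: ((0, v) : V1 * V2)) - f p)).
  apply/funext => h /=; case: p => x y /=; rewrite /shift /=.
  by congr (_ *: (f (_, _) - _)); rewrite /= scaler0 add0r.
have dE p : O p -> pderivable v f p /\ pderive v f p = g p.
  by move=> /fg; rewrite /derivable /derive -E.
split=> [p /dE[] //|].
by apply: PCk_eq (IH _ Cg) => // p /dE[].
Qed.

Lemma Ck_on_coord V (m : nat) (U : set V) (k : nat) (r : V -> 'rV[R]_m) (i : 'I_m) :
  Ck_on (W := ('rV[R]_m : normedModType R)) U k r ->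
    Ck_on (W := R^o) U k (fun x => r x 0 i).
Proof.
have cc (g : V -> 'rV[R]_m) x : {for x, continuous g} ->
  {for x, continuous (fun x => g x 0 i : R^o)}.
  move=> cg; apply: (@continuous_comp _ _ _ g (fun M : 'rV[R]_m => M 0 i : R^o)) => //.
  exact: coord_continuous.
elim: k r => [|k IH] r [cr dr]; split=> //; try by move=> x Ux; apply: cc; exact: cr.
move=> v; have [g rg Cg] := dr v; exists (fun x => g x 0 i); last exact: IH.
move=> x /rg h; rewrite /dirderiv_at.
have -> : (fun h : R => h^-1 *: ((r (h *: v + x) 0 i : R^o) - r x 0 i)) =
    (fun M : 'rV[R]_m => M 0 i) \o (fun h => h^-1 *: (r (h *: v + x) - r x)).
  by apply/funext => t /=; rewrite !mxE.
apply: continuous_cvg => //; exact: coord_continuous.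
Qed.

End param_smooth.



(** * Smooth functions flat at the origin *)

Section flat.
Variable R : realType.
Implicit Types (X : topologicalType) (V : normedModType R).

(** Restricting [f] to the line through [y] along [v] reduces this to the chain rule in one
    variable. *)
Lemma is_derive_comp1 V (phi : R -> R) (f : V -> R^o) y v (a b : R) :
  is_derive (f y) 1 phi a -> is_derive y v f b ->
  is_derive y v (fun z => phi (f z) : R^o) (a * b).
Proof.
move=> dphi [df fb].
have d0 : is_derive (0 : R) 1 (fun s : R => f (s *: v + y) : R) b.
  rewrite -fb; have := @is_derive_line R V f y v 0; rewrite scale0r add0r; exact.
have dphi' : is_derive ((fun s : R => f (s *: v + y) : R) 0) 1 phi a.
  by rewrite /= scale0r add0r.
have [d e] := is_derive1_comp dphi' d0.
have E : (fun h : R => h^-1 *: (((phi \o (fun s : R => f (s *: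
  v + y))) \o shift 0) (h *: 1) -
      (phi \o (fun s : R => f (s *: v + y))) 0)) =
    (fun h : R => h^-1 *: (((fun z => phi (f z) : R^o) \o shift y) (h *:
      v) - phi (f y))).
  by apply/funext => h /=; rewrite /shift /= addr0 scale0r add0r [h *: 1]mulr1.
by split; [move: d; rewrite /derivable E|move: e; rewrite /derive E].
Qed.

Lemma PCkV X V (O : set (X * V)) k f : open O -> (forall p, O p -> f p != 0) ->
  PCk O k f -> PCk O k (fun p => (f p)^-1).
Proof.
move=> oO f0; elim: k => [|k IH] Cf.
  by have [cf _] := Cf; split=> // p Op; apply: cvgV; [exact: f0|exact: cf].
have [cf df] := Cf.
split=> [p Op|v]; first by apply: cvgV; [exact: f0|exact: cf].
have [dv Cv] := df v; have Ci := IH (PCkW Cf); split=> [[x y] Oxy|].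
  by apply: derivableV; [exact: (f0 _ Oxy)|exact: (dv _ Oxy)].
apply: (PCk_eq oO _ (PCkM oO (PCkM oO (PCk_cst _ _ (-1)) (PCkM oO Ci Ci)) Cv)).
move=> [x y] Oxy.
rewrite /pderive (deriveV (f0 _ Oxy) (dv _ Oxy)) /=.
by rewrite mulN1r expr2 invfM.
Qed.

(* Together with 0, the functions [flat n] are stable under differentiation up to
   linear combinations; [flat 0] is positive exactly on the positive reals. *)
Definition flat (n : nat) (t : R) : R :=
  if 0 < t then t^-1 ^+ n * expR (- t^-1) else 0.

(** With [N = n + 1] and [s = 1 / t], the inequality [expR (s / N) >= s / N] raised to the power [N]
    gives [s ^ N <= N ^ N * expR s]. *)
Lemma flat_bound n t : 0 <= flat n t <= n.+1%:R ^+ n.+1 * `|t|.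
Proof.
rewrite /flat; case: ifPn => t0; last by rewrite lexx mulr_ge0.
have s0 : 0 < t^-1 by rewrite invr_gt0.
rewrite mulr_ge0 ?exprn_ge0 ?expR_ge0 ?(ltW s0)//= gtr0_norm//.
have N0 : 0 < n.+1%:R :> R by rewrite ltr0n.
rewrite expRN ler_pdivrMr ?expR_gt0//.
rewrite -(ler_pM2r s0) -exprSr.
have -> : n.+1%:R ^+ n.+1 * t * expR t^-1 * t^-1 = n.+1%:R ^+ n.+1 * expR t^-1.
  by field; rewrite gt_eqF.
have -> : t^-1 = n.+1%:R * (t^-1 / n.+1%:R) by rewrite mulrCA divff ?mulr1// gt_eqF.
rewrite expRM_natl exprMn ler_pM2l ?exprn_gt0//.
rewrite lerXn2r ?nnegrE ?expR_ge0 ?divr_ge0 ?(ltW s0)//.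
by rewrite (le_trans _ (expR_ge1Dx _))// lerDr.
Qed.

Lemma is_derive_flat n (t : R) :
  is_derive t 1 (flat n) (flat n.+2 t - n%:R * flat n.+1 t).
Proof.
have [t0|t0|->] := ltgtP t 0.
- have -> : flat n.+2 t - n%:R * flat n.+1 t = 0.
    by rewrite /flat ltNge ltW//= mulr0 subr0.
  apply: (@near_eq_is_derive _ _ _ (cst 0)).
    have := lt_nbhsl t0; apply: filterS => s s0.
    by rewrite /flat ltNge ltW.
- apply: (@near_eq_is_derive R R R (fun s : R => s^-1 ^+ n * expR (- s^-1))).
    have := lt_nbhsr t0; apply: filterS => s s0.
    by rewrite /flat s0.
  rewrite /flat t0.
  have dinv : is_derive t 1 (fun s : R => s^-1) (- t ^- 2 *: 1).
    by apply: (@is_deriveV R id) => //; rewrite gt_eqF.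
  have dX := is_deriveX n dinv.
  have dE := @is_derive1_comp R expR (fun s : R => - s^-1) t _ _
    (is_derive_expR (- t^-1)) (is_deriveN dinv).
  have := is_deriveM dX dE.
  have -> : (fun s : R => s^-1) ^+ n * (expR \o (fun s : R => - s^-1)) =
      (fun s : R => s^-1 ^+ n * expR (- s^-1)) by apply/funext => s; rewrite !fctE.
  move/is_derive_eq; apply.
  have -> : ((fun s : R => s^-1) ^+ n) t = t^-1 ^+ n by rewrite !fctE.
  rewrite -exprVn.
  change (t^-1 ^+ n * (expR (- t^-1) * - (- t^-1 ^+ 2 * 1)) +
      expR (- t^-1) * (n%:R * t^-1 ^+ n.-1 * (- t^-1 ^+ 2 * 1)) =
    t^-1 ^+ n.+2 * expR (- t^-1) - n%:R * (t^-1 ^+ n.+1 * expR (- t^-1))).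
  move: (expR (- t^-1)) (t^-1) => E s.
  by case: n {dX} => [|j] /=; rewrite ?exprS; ring.
- have -> : flat n.+2 0 - n%:R * flat n.+1 0 = 0.
    by rewrite /flat ltxx mulr0 subr0.
  (* At 0 the difference quotient of [flat n] is [flat n.+1], which tends to 0 by [flat_bound]. *)
  suff c : (fun h : R => h^-1 *: ((flat n \o shift 0) (h *: 1) - flat n 0)) @ 0^' -->
    (0 : R).
    by split; [apply/cvg_ex; exists 0|exact: cvg_lim c].
  apply/cvgrPdist_le => e e0.
  pose C : R := n.+2%:R ^+ n.+2.
  have C0 : 0 < C by rewrite exprn_gt0.
  near=> h.
  have -> : h^-1 *: ((flat n \o shift 0) (h *: 1) - flat n 0) = flat n.+1 h.
    rewrite /= /shift /= addr0 [h *: 1]mulr1 /flat ltxx subr0.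
    case: ifP => _; last by rewrite scaler0.
    by rewrite exprS -mulrA.
  have /andP[f0 fC] := flat_bound n.+1 h.
  rewrite sub0r normrN ger0_norm// (le_trans fC)// -/C.
  rewrite -ler_pdivlMl//; near: h; apply: dnbhs0_le.
  by rewrite mulr_gt0// invr_gt0.
Unshelve. all: by end_near. Qed.

(** The induction is on [k] for all [n] at once, since one derivative of [flat n] involves
    [flat n.+1] and [flat n.+2]. *)
Lemma PCk_flat X V (O : set (X * V)) n k f : open O ->
  PCk O k f -> PCk O k (fun p => flat n (f p)).
Proof.
move=> oO.
have cflat j t : {for t, continuous (flat j)}.
  apply: differentiable_continuous; apply/derivable1_diffP.
  by have [] := is_derive_flat j t.
elim: k n f => [|k IH] n f Cf.
  have [cf _] := Cf; split=> // p Op.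
  by apply: (@continuous_comp _ _ _ f (flat n)); [exact: cf|exact: cflat].
have [cf df] := Cf; split=> [p Op|v].
  by apply: (@continuous_comp _ _ _ f (flat n)); [exact: cf|exact: cflat].
have [dv Cv] := df v.
have D x y : O (x, y) -> is_derive y v (fun z => flat n (f (x, z)) : R^o)
    ((flat n.+2 (f (x, y)) - n%:R * flat n.+1 (f (x, y))) * pderive v f (x, y)).
  move=> Oxy; apply: is_derive_comp1; first exact: is_derive_flat.
  by apply: derivableP; exact: (dv _ Oxy).
split=> [[x y] /D[] //|].
apply: (@PCk_eq _ _ _ _ _ (fun p => (flat n.+2 (f p) + - n%:R * flat n.+1 (f p))
  * pderive v f p)) => //.
  by move=> [x y] /D[_ e]; rewrite mulNr; exact: esym e.
have Cfk := PCkW Cf.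
apply: PCkM => //; apply: PCkD => //; first exact: IH.
by apply: PCkM => //; [exact: PCk_cst|exact: IH].
Qed.

End flat.



(** * Differentiation under the functional *)

Section param_functional.
Variables (R : realType) (G : topologicalType) (V : normedModType R).
Hypothesis bG : bumps R G.
Variable J : (G -> R) -> R.
Hypothesis Jlin : forall a f g, Cc f -> Cc g ->
  J (fun x => a * f x + g x) = a * J f + J g.
Hypothesis Jpos : forall f, Cc f -> (forall x, 0 <= f x) -> 0 <= J f.
Implicit Types (f : G * V -> R^o) (U : set V).

Lemma functional0 : J (fun=> 0) = 0.
Proof.
have := Jlin (-1) (@Cc0 R G) (@Cc0 R G).
by under eq_fun do rewrite mulr0 addr0; rewrite mulN1r addNr.
Qed.

(** Positivity of [J] applied to [e * chi - h] and [e * chi + h]: a positive functional is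
    continuous for uniform convergence with support in a fixed compact set. *)
Lemma functional_bound K chi (h : G -> R) e : 0 <= e -> Cc chi ->
  (forall x, 0 <= chi x) ->
  (forall x, K x -> 1 <= chi x) -> Cc h ->
  (forall x, K x -> `|h x| <= e) -> (forall x, ~ K x -> h x = 0) ->
  `|J h| <= e * J chi.
Proof.
move=> e0 Cchi chi0 chi1 Ch hK hnK.
have hle x : `|h x| <= e * chi x.
  have [Kx|/hnK ->] := pselect (K x); last by rewrite normr0 mulr_ge0.
  by rewrite (le_trans (hK _ Kx))// ler_peMr// chi1.
have C0 := @Cc0 R G.
have JZ : J (fun x => e * chi x) = e * J chi.
  have := Jlin e Cchi C0; rewrite functional0 addr0.
  by under eq_fun do rewrite addr0.
have CZ : Cc (fun x => e * chi x) by exact: CcZ.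
rewrite ler_norml; apply/andP; split.
  rewrite -subr_ge0 opprK -JZ addrC -[X in _ + X]mul1r addrC -Jlin//.
  apply: Jpos => [|x]; first exact: Cc_lin.
  by rewrite mul1r; have := hle x; rewrite ler_norml => /andP[+ _]; lra.
rewrite -subr_ge0 -JZ addrC -mulN1r -Jlin//.
apply: Jpos => [|x]; first exact: Cc_lin.
by have := hle x; rewrite ler_norml => /andP[_]; lra.
Qed.

(** Around each [(g, y)], both [f (a, z)] and [f (a, y)] are within [e / 2] of [f (g, y)];
    compactness of [K] makes one neighbourhood of [y] suffice. *)
Lemma compact_uniform_near f (K : set G) y e : compact K -> (forall g, K g ->
  {for (g, y), continuous f}) ->
  0 < e -> \forall z \near y, forall g, K g -> `|f (g, z) - f (g, y)| <= e.
Proof.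
move=> cK cf e0.
apply: (@iffLR _ _ (compact_near_coveringP K) cK _ _
  (fun z g => `|f (g, z) - f (g, y)| <= e)) => g Kg.
have e2 : 0 < e / 2 by rewrite divr_gt0.
have n1 : \forall p \near (g, y), `|f (g, y) - f p| <= e / 2.
  by have /cvgrPdist_le/(_ _ e2) := cf g Kg.
have c : {for (g, y), continuous (fun p : G * V => (p.1, y))}.
  by apply: cvg_pair; [exact: cvg_fst|exact: cvg_cst].
have n2 : \forall p \near (g, y), `|f (g, y) - f (p.1, y)| <= e / 2.
  exact: (c _ n1).
have : \forall p \near (g, y), `|f (p.1, p.2) - f (p.1, y)| <= e.
  apply: filterS2 n1 n2 => -[a b] /= h1 h2.
  rewrite -(subrKA (f (g, y))) (le_trans (ler_normD _ _))// (splitr e) lerD//.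
  by rewrite distrC.
by [].
Qed.

(* The support in G of f(., z) stays in a fixed compact set for z near y. *)
Definition lsupp U f := forall y, U y -> exists2 K, compact K &
  \forall z \near y, forall g, ~ K g -> f (g, z) = 0.

Lemma Cc_slice U f y : (forall p, (setT `*` U) p -> {for p, continuous f}) ->
  lsupp U f -> U y -> Cc (fun g => f (g, y) : R).
Proof.
move=> cf sf Uy; split.
  move=> g; apply: (@continuous_comp _ _ _ (fun g => (g, y)) f); last exact: cf.
  by apply: cvg_pair; [exact: cvg_id|exact: cvg_cst].
by have [K cK nK] := sf y Uy; exists K => //; exact: nbhs_singleton nK.
Qed.

Lemma lsupp_pderive U f v : lsupp U f -> lsupp U (pderive v f).
Proof.
move=> sf y /sf[K cK nK]; exists K => //.
(* A derivative at [z] sees [f] around [z], so the vanishing must hold on a neighbourhood of [z];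
   hence the passage to the interior. *)
have := nK; rewrite -nbhs_nearE => /nbhs_interior; apply: filterS => z nz g Kg.
rewrite /pderive /= (@near_eq_derive _ _ _ _ (cst 0)) ?derive_cst//.
by apply: filterS nz => w /(_ g Kg).
Qed.

Lemma functional_continuous U f y : (forall p, (setT `*` U) p ->
  {for p, continuous f}) ->
  lsupp U f -> open U -> U y ->
  {for y, continuous (fun z => J (fun g => f (g, z)) : R^o)}.
Proof.
move=> cf sf oU Uy; have [K cK nK] := sf y Uy.
have [chi [Cchi chi0] chi1] := Cc_ge1 bG cK.
have Jchi := Jpos Cchi chi0.
apply/cvgrPdist_le => e e0.
(* Chosen so that [d * J chi <= e], also when [J chi = 0]. *)
pose d := e / (J chi + 1).
have d0 : 0 < d by rewrite divr_gt0// ltr_wpDl.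
have nU : \forall z \near y, U z by exact: open_nbhs_nbhs.
have nT : \forall z \near y, forall g, K g -> `|f (g, z) - f (g, y)| <= d.
  by apply: compact_uniform_near => // g _; exact: cf.
near=> z.
have Uz : U z by near: z.
have Cz := Cc_slice cf sf Uz; have Cy := Cc_slice cf sf Uy.
have -> : J (fun g => f (g, y)) - J (fun g => f (g, z)) =
    J (fun g => -1 * f (g, z) + f (g, y)) by rewrite Jlin// mulN1r addrC.
apply: (@le_trans _ _ (d * J chi)).
  apply: (@functional_bound K) => //; first exact: ltW.
  - exact: Cc_lin.
  - move=> g Kg; rewrite mulN1r addrC distrC; move: g Kg; near: z.
    exact: nT.
  - move=> g Kg; rewrite (nbhs_singleton nK)//.
    have -> : f (g, z) = 0 by move: g Kg; near: z.
    by rewrite mulr0 addr0.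
rewrite /d mulrAC ler_pdivrMr ?ltr_wpDl//.
by rewrite ler_pM2l// lerDl.
Unshelve. all: by end_near. Qed.

(** By [increment_bound] and compactness, the first-order remainder of [f (g, _)] at [y] is at most
    [d * |h|] for all [g] in [K] at once; [J] turns this into [d * |h| * J chi], and the factor
    [|h|] cancels. *)
Lemma functional_derive U f y v : open U -> PCk (setT `*` U) 1 f -> lsupp U f -> U y ->
  dirderiv_at (W := R^o) (fun z => J (fun g => f (g, z))) y v
    (J (fun g => pderive v f (g, y))).
Proof.
move=> oU [cf /(_ v)[df [cdf _]]] sf Uy; have [K cK nK] := sf y Uy.
have [chi [Cchi chi0] chi1] := Cc_ge1 bG cK.
have Jchi := Jpos Cchi chi0.
apply/cvgrPdist_le => e e0.
pose d := e / (J chi + 1).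
have d0 : 0 < d by rewrite divr_gt0// ltr_wpDl.
have nU : \forall z \near y, U z by exact: open_nbhs_nbhs.
have nT : \forall z \near y, forall g, K g ->
    `|pderive v f (g, z) - pderive v f (g, y)| <= d.
  by apply: compact_uniform_near => // g _; exact: cdf.
have Cy := Cc_slice cf sf Uy.
have CD := Cc_slice cdf (lsupp_pderive v sf) Uy.
have D0 g : ~ K g -> pderive v f (g, y) = 0.
  move=> Kg; rewrite /pderive /= (@near_eq_derive _ _ _ _ (cst 0)) ?derive_cst//.
  by apply: filterS nK => w /(_ g Kg).
have cl : {for (0 : R), continuous (fun t : R => t *: v + y)}.
  apply: cvgD; last exact: cvg_cst.
  exact: scalel_continuous.
have : \forall t \near (0 : R), [/\ U (t *: v + y),
    (forall g, ~ K g -> f (g, t *: v + y) = 0) &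
    (forall g, K g -> `|pderive v f (g, t *: v + y) - pderive v f (g, y)| <= d)].
  have nall : nbhs ((0 : R) *: v + y) [set z | [/\ U z, (forall g, ~ K g ->
    f (g, z) = 0) &
    (forall g, K g -> `|pderive v f (g, z) - pderive v f (g, y)| <= d)]].
    rewrite scale0r add0r; near=> z; split; near: z => //.
  exact: (cl _ nall).
move=> /nbhs_ballP[r /= r0 rB].
near=> h.
have hr : `|h| < r.
  by near: h; exact: dnbhs0_lt.
have h0 : h != 0 by near: h; exact: nbhs_dnbhs_neq.
have B (t : R) : `|t| <= `|h| -> ball (0 : R) r t.
  by move=> th; rewrite -ball_normE /= sub0r normrN (le_lt_trans th).
have [Uh sh _] := rB h (B h (lexx _)).
have Ch := Cc_slice cf sf Uh.
have E : J (fun g => pderive v f (g, y)) -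
     h^-1 *: ((J (fun g => f (g, h *: v + y)) : R^o) - J (fun g => f (g, y))) =
    - h^-1 * J (fun g => - h * pderive v f (g, y) +
       (-1 * f (g, y) + f (g, h *: v + y))).
  rewrite Jlin//; last exact: Cc_lin.
  rewrite Jlin// -[_ *: _]/(_ * _); by field.
rewrite E normrM normrN normfV.
rewrite ler_pdivrMl ?normr_gt0//.
apply: (@le_trans _ _ (d * `|h| * J chi)).
  apply: (@functional_bound K) => //; first by rewrite mulr_ge0// ltW.
  - by apply: Cc_lin => //; exact: Cc_lin.
  - move=> g Kg.
    have -> : - h * pderive v f (g, y) + (-1 * f (g, y) + f (g, h *: v + y)) =
      f (g, h *: v + y) - f (g, y) - h * pderive v f (g, y) by ring.
    apply: (@increment_bound R V (fun z => f (g, z)) y v h _ d) => t /B/rB[Ut _ tK].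
      exact: (df (g, t *: v + y)).
    exact: tK.
  - move=> g Kg; rewrite D0// sh// (nbhs_singleton nK)//.
    by rewrite !mulr0 !addr0.
rewrite mulrAC [leRHS]mulrC ler_wpM2r//.
rewrite /d mulrAC ler_pdivrMr ?ltr_wpDl//.
by rewrite ler_pM2l// lerDl.
Unshelve. all: by end_near. Qed.

Lemma functional_Ck U f k : open U -> PCk (setT `*` U) k f -> lsupp U f ->
  Ck_on (W := R^o) U k (fun y => J (fun g => f (g, y))).
Proof.
move=> oU; elim: k f => [|k IH] f Cf sf.
  split=> // y; rewrite inE => Uy.
  by apply: functional_continuous sf oU Uy => p Op; exact: PCk_cont Cf Op.
have [cf df] := Cf; split=> [y|v].
  by rewrite inE => Uy; apply: functional_continuous sf oU Uy => p Op;
    exact: PCk_cont Cf Op.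
exists (fun y => J (fun g => pderive v f (g, y))) => [y Uy|].
  apply: functional_derive sf Uy => //; split=> // w; have [h Ck] := df w.
  by split=> //; split=> // p Op; exact: PCk_cont Ck Op.
by apply: IH; [have [] := df v|exact: lsupp_pderive].
Qed.

End param_functional.



Lemma closed_ball_compact (R : realType) m (y : 'rV[R]_m) (r : R) : 0 < r ->
  compact (closed_ball y r).
Proof.
move=> r0; apply: bounded_closed_compact; last exact: closed_ball_closed.
exists (`|y| + r); split; first exact: num_real.
move=> N yN u; rewrite closed_ballE// /closed_ball_ /= => yu.
rewrite (le_trans _ (ltW yN))// -[u](subKr y) (le_trans (ler_normB _ _))//.
by rewrite lerD2l.
Qed.

Lemma closed_ball_sub_open (R : realType) (V : normedModType R) (U : set V) (y : V) :
  open U -> U y -> exists2 r, 0 < r & closed_ball y r `<=` U.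
Proof.
move=> oU Uy; have /nbhs_ballP[r /= r0 rU] : nbhs y U by exact: open_nbhs_nbhs.
exists (r / 2); first by rewrite divr_gt0.
apply: subset_trans rU; apply: closed_ball_subset; first by rewrite divr_gt0.
by rewrite ltr_pdivrMr// ltr_pMr// ltr1n.
Qed.

Lemma nbhs_closed_ball (R : realType) (V : normedModType R) (y : V) (r : R) :
  0 < r -> nbhs y (closed_ball y r).
Proof.
by move=> r0; apply: filterS (@subset_closed_ball _ _ y r) _; exact: nbhsx_ballx.
Qed.

(** * Charts and smooth functions on manifolds *)

Section Cinfty_topology.
Variables (R : realType) (m : nat) (M : topologicalType).
Variable A : set (chart M 'rV[R]_m).

(** Projects the supremum topology onto its component [(psi, vs)], where convergence means uniform
    convergence on [K]. *)
Lemma cvg_Cinfty_uniform (T : Type) (F : set_system T) (L : T ->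
  Cinfty A) (f : Cinfty A)
    psi vs (K : set 'rV[R]_m) (e : R) : Filter F ->
  A psi -> compact K -> K `<=` chart_img psi -> 0 < e ->
  L @ F --> f ->
  \forall t \near F, forall y, K y ->
    `|chart_derivative psi vs f y - chart_derivative psi vs (L t) y| < e.
Proof.
move=> FF Apsi cK Kpsi e0 Lf.
have FL : Filter (L @ F) by exact: fmap_filter.
have /= h := (@cvg_sup (Cinfty A) _ _ (L @ F) f FL).1 Lf (exist _ psi Apsi, vs).
pose fam := (fun K => compact K /\ K `<=` chart_img psi).
pose g : Cinfty A -> {family fam, 'rV[R]_m -> R^o} := chart_derivative psi vs.
have gf : (g \o L) @ F --> g f.
  apply: cvg_comp h _.
  exact: (@initial_continuous _ _ g f).
have := (@fam_cvgP 'rV[R]_m R^o fam ((g \o L) @ F) (g f) (fmap_filter _ FF)).1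
  gf K (conj cK Kpsi).
move=> /(_ [set u | forall y, K y -> `|chart_derivative psi vs f y - u y| < e]).
apply.
apply/uniform_nbhs; exists [set xy : R^o * R^o | ball xy.1 e xy.2]; split.
  exact: (@entourage_ball R R^o (PosNum e0)).
by move=> u uy y /uy; rewrite -ball_normE.
Qed.


Lemma chart_derivative_PCk X psi vs (f : Cinfty A) k : is_chart psi -> A psi ->
  PCk (X := X) (snd @^-1` chart_img psi) k (chart_derivative psi vs f \o snd).
Proof.
move=> [_ oI _ _ _] Apsi.
have /asboolP sf := Cinfty_smooth f.
elim: vs k => [|v vs IH] k.
  by apply: PCk_of_Ck => //; exact: sf.
by have [_ /(_ v)[_]] := IH k.+1.
Qed.

(** Continuity for the C^oo topology gives, on a closed ball around [y], uniform convergence of each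
    derivative of [L]; with the continuity of that derivative for fixed [L x], this is joint
    continuity. The induction runs over all [vs], as one more derivative is [v :: vs]. *)
Lemma PCk_chart_derivative (X : topologicalType) (L : X -> Cinfty A) psi vs k :
  is_chart psi -> A psi -> continuous L ->
  PCk (setT `*` chart_img psi) k (fun p => chart_derivative psi vs (L p.1) p.2).
Proof.
move=> cpsi Apsi cL; have [_ oI _ _ _] := cpsi.
have cont vs' p : (setT `*` chart_img psi) p ->
    {for p, continuous (fun p : X * 'rV[R]_m => chart_derivative psi vs' (L p.1) p.2)}.
  case: p => x y [_ /= Iy].
  have [r r0 KI] := closed_ball_sub_open oI Iy.
  pose K := closed_ball y r.
  have cK : compact K by exact: closed_ball_compact.
  apply/cvgrPdist_lt => e e0.
  have e2 : 0 < e / 2 by rewrite divr_gt0.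
  have n1 : \forall p \near (x, y), forall z, K z ->
      `|chart_derivative psi vs' (L x) z - chart_derivative psi vs' (L p.1) z| < e / 2.
    have H := cvg_Cinfty_uniform vs' _ Apsi cK KI e2 (cL x).
    have cfst : {for (x, y), continuous (@fst X 'rV[R]_m)} by exact: cvg_fst.
    exact: (cfst _ (H _)).
  have c0 : {for (x, y), continuous (chart_derivative psi vs' (L x) \o (@snd X _))}.
    exact: (PCk_cont (@chart_derivative_PCk X psi vs' (L x) 0 cpsi Apsi)).
  have n2 : \forall p \near (x, y), `|chart_derivative psi vs' (L x)
    y - chart_derivative psi vs' (L x) p.2| < e / 2.
    by have /cvgrPdist_lt/(_ _ e2) := c0.
  have n3 : \forall p \near (x, y), K p.2.
    have : nbhs y K by exact: nbhs_closed_ball.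
    have csnd : {for (x, y), continuous (@snd X 'rV[R]_m)} by exact: cvg_snd.
    exact: csnd.
  near=> p => /=.
  rewrite -(subrKA (chart_derivative psi vs' (L x) p.2))
    (le_lt_trans (ler_normD _ _))//.
  rewrite (splitr e) ltrD//; first by near: p.
  have Kp : K p.2 by near: p.
  by move: (p.2) Kp; near: p.
elim: k vs => [|k IH] vs; first by split=> // p; exact: cont.
split=> [p|v]; first exact: cont.
split=> [[x y] [_ Iy]|]; last exact: (IH (v :: vs)).
have [_ /(_ v)[h _]] := @chart_derivative_PCk X psi vs (L x) 1 cpsi Apsi.
exact: (h (x, y)).
Unshelve. all: by end_near. Qed.

End Cinfty_topology.

Section lambda.
Variables (R : realType) (n : nat) (G : topGroupType) (AG : set (chart G 'rV[R]_n)).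
Variable (W : preTopologicalLmodType R).

(** Order 0 of the smoothness of the cochain, read in a chart. Charts of ['I_1 -> G] have [1 x n]
    matrices as model, and [row_id] identifies these with row vectors. *)
Lemma smooth_cochain1_continuous (lam : cochain G W 1) :
  (forall phi, AG phi -> is_chart phi) ->
  (forall x : G, exists2 phi, AG phi & chart_dom phi x) ->
  smooth_cochains AG lam -> continuous (fun g : G => lam (fun=> g)).
Proof.
move=> cAG covG slam g; have [phi Aphi dg] := covG g.
have [od oI [fI _] [fK _] [cf _]] := cAG _ Aphi.
have /= := slam (pow_chart (fun _ : 'I_1 => phi)) _ 0.
move=> /(_ _)[|h _]; first by exists (fun=> phi).
pose u := chart_fun phi g.
have Iu : forall i : 'I_1, chart_img phi (row i (u : 'M[R]_(1, n))).
  by move=> i; rewrite row_id; exact: fI.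
have cu := h u _.
have {}cu : {for u, continuous (lam \o (fun v i => chart_inv phi (row i v)))}.
  by apply: cu; rewrite inE.
have cgu : {for g, continuous (chart_fun phi)} by apply: cf; rewrite inE.
apply: near_eq_continuous; last first.
  apply: (@continuous_comp _ _ _ (chart_fun phi)
    (lam \o (fun v i => chart_inv phi (row i v)))) => //.
have : nbhs g (chart_dom phi) by exact: open_nbhs_nbhs.
apply: filterS => z dz /=; congr lam; apply/funext => i.
by rewrite row_id fK// inE.
Qed.

End lambda.



Lemma pair_continuous_at (T U V : topologicalType) (f : T -> U) (g : T -> V) t :
  {for t, continuous f} -> {for t, continuous g} ->
  {for t, continuous (fun x => (f x, g x))}.
Proof. by move=> cf cg; exact: cvg_pair. Qed.

Lemma open_setX (X Y : topologicalType) (A : set X) (B : set Y) :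
  open A -> open B -> open (A `*` B).
Proof.
move=> oA oB; rewrite openE => -[x y] [/= Ax By].
by exists (A, B) => //; split; exact: open_nbhs_nbhs.
Qed.

Lemma open_setI_preimage (X Y : topologicalType) (A : set X) (B : set Y) (f : X -> Y) :
  open A -> {in A, continuous f} -> open B -> open (A `&` f @^-1` B).
Proof.
move=> oA cf oB; rewrite openE => x [Ax Bfx]; apply: filterI.
  exact: open_nbhs_nbhs.
by apply: (cf x); [rewrite inE|exact: open_nbhs_nbhs].
Qed.

Section smooth_param.
Variables (R : realType) (m : nat) (M : topologicalType) (A : set (chart M 'rV[R]_m)).
Implicit Types (X : topologicalType) (V : normedModType R).

(* The map r into M is smooth in its second variable, in the sense of [PCk]. *)
Definition smooth_param X V (O : set (X * V)) (k : nat) (r : X * V -> M) :=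
  forall p, O p -> forall chi, A chi -> chart_dom chi (r p) ->
  exists2 W, [/\ open W, W p & forall q, W q -> chart_dom chi (r q)] &
    forall i, PCk W k (fun q => chart_fun chi (r q) 0 i).

Lemma PCk_smooth_fun X V (O : set (X * V)) k (r : X * V -> M) (f : M -> R^o) :
  smooth_manifold A -> smooth_fun A f -> smooth_param O k r ->
  PCk O k (fun p => f (r p)).
Proof.
move=> [_ _ charts cover _] sf sr; apply: PCk_local => p Op.
have [chi Achi dchi] := cover (r p).
have [W [oW Wp dW] Ck] := sr p Op chi Achi dchi.
have [_ oI [fI _] [fK _] _] := charts _ Achi.
exists W => //.
apply: (@PCk_eq _ _ _ _ _ ((f \o chart_inv chi) \o (fun q => chart_fun chi (r q))))
  => //.
  by move=> q /dW dq /=; rewrite fK// inE.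
apply: (PCk_comp oW oI) => //; first by move=> q /dW; exact: fI.
by apply: PCk_of_Ck => //; exact: sf.
Qed.

Lemma smooth_param_chart_inv X psi k : smooth_manifold A -> A psi ->
  smooth_param (X := X) (snd @^-1` chart_img psi) k (fun p => chart_inv psi p.2).
Proof.
move=> [_ _ charts cover compat] Apsi p Ip chi Achi dchi.
have [_ oI _ _ [_ cinv]] := charts _ Apsi; have [od _ _ _ _] := charts _ Achi.
pose Q := chart_img psi `&` [set u | chart_dom chi (chart_inv psi u)].
have oQ : open Q by exact: open_setI_preimage.
exists (snd @^-1` Q) => [|i].
  split=> //; first by apply: open_comp => // q _; exact: cvg_snd.
  by move=> q [].
apply: (@PCk_of_Ck R X _ Q k (fun u => chart_fun chi (chart_inv psi u) 0 i)) => //.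
by apply: Ck_on_coord; exact: (compat psi chi Apsi Achi k).
Qed.

Lemma smooth_fun_continuous (f : M -> R^o) : smooth_manifold A -> smooth_fun A f ->
  continuous f.
Proof.
move=> [_ _ charts cover _] sf x; have [chi Achi dx] := cover x.
have [od oI [fI _] [fK _] [cfun _]] := charts _ Achi.
apply: (@near_eq_continuous _ _ ((f \o chart_inv chi) \o chart_fun chi)).
  have : nbhs x (chart_dom chi) by exact: open_nbhs_nbhs.
  by apply: filterS => z dz /=; rewrite fK// inE.
apply: continuous_comp; first by apply: cfun; rewrite inE.
by have [c _] := sf chi Achi 0; apply: c; rewrite inE; exact: fI.
Qed.

Lemma PCk_coord X (O : set (X * 'rV[R]_m)) k i : open O -> PCk O k (fun p => p.2 0 i).
Proof.
move=> oO; have dE (x y v : 'rV[R]_m) : is_derive y v (fun z : 'rV[R]_m => z 0 i :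
  R^o) (v 0 i).
  have did : derivable (@id 'rV[R]_m) y v by exact: derivable_id.
  split; first by move/derivable_mxP: did; exact.
  have := derive_id y v; rewrite derive_mx// => /rowP/(_ i); by rewrite mxE.
have cE p : {for p, continuous (fun p : X * 'rV[R]_m => p.2 0 i : R^o)}.
  apply: (@continuous_comp _ _ _ snd (fun M : 'rV[R]_m => M 0 i : R^o));
    first exact: cvg_snd.
  exact: coord_continuous.
case: k => [|k]; first by split.
split=> // v; split=> [[x y] _|]; first by have [] := dE y y v.
apply: PCk_eq (PCk_cst _ k (v 0 i)) => // -[x y] _.
by have [_ ] := dE y y v.
Qed.

(** A bump in one chart, extended by 0. The extension is smooth because its support lies in a
    compact set inside the chart domain, and this set is closed in the Hausdorff space [M]. *)
Lemma smooth_bump p (U : set M) : smooth_manifold A -> nbhs p U ->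
  exists2 b : M -> R^o, [/\ smooth_fun A b, forall x, 0 <= b x & 0 < b p] &
  exists2 K, compact K /\ K `<=` U & forall x, ~ K x -> b x = 0.
Proof.
move=> mA nU; have [hM _ charts cover compat] := mA.
have [phi Aphi dp] := cover p.
have [od oI [fI invD] [fK invK] [cfun cinv]] := charts _ Aphi.
pose u0 := chart_fun phi p.
have Iu0 : chart_img phi u0 by exact: fI.
have pK : chart_inv phi u0 = p by rewrite /u0 fK// inE.
have : nbhs u0 (chart_img phi `&` chart_inv phi @^-1` U).
  apply: filterI; first exact: open_nbhs_nbhs.
  by apply: cinv; rewrite ?inE// pK.
rewrite nbhsE => -[N [oN0 Nu0] NU].
have [s s0 sN] := closed_ball_sub_open oN0 Nu0.
(* The norm of row vectors is the maximum norm, whose balls are cubes; a product of one-variable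
   bumps therefore vanishes off the ball of radius [s]. *)
pose B (u : 'rV[R]_m) : R := \prod_i flat 0 (s ^+ 2 - (u 0 i - u0 0 i) ^+ 2).
have B0 u : 0 <= B u.
  by apply: prodr_ge0 => i _; have /andP[] :=
    flat_bound 0 (s ^+ 2 - (u 0 i - u0 0 i) ^+ 2).
have Bu0 : 0 < B u0.
  apply: prodr_gt0 => i _; rewrite subrr expr0n subr0 /flat exprn_gt0//.
  by rewrite expr0 mul1r expR_gt0.
have Bout u : ~ closed_ball u0 s u -> B u = 0.
  rewrite closed_ballE// /closed_ball_ /= => /negP; rewrite -ltNge => su.
  have [i si] : exists i, s < `|u0 0 i - u 0 i|.
    apply: contrapT => /forallNP h; move: su; apply/negP; rewrite -leNgt.
    rewrite [leLHS]/Num.Def.normr/= mx_normrE (bigmax_le _ (ltW s0))//= => -[i j] _.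
    rewrite !ord1 mxE [X in _ + X]mxE leNgt; apply/negP; exact: h.
  rewrite /B (bigD1 i)//= /flat ltNge.
  have -> : s ^+ 2 - (u 0 i - u0 0 i) ^+ 2 <= 0.
    rewrite subr_le0 -[leRHS]real_normK ?num_real// distrC lerXn2r ?nnegrE//;
      exact: ltW.
  by rewrite mul0r.
pose K := chart_inv phi @` closed_ball u0 s.
have KI : closed_ball u0 s `<=` chart_img phi by move=> u /sN/NU[].
have cK : compact K.
  apply: continuous_compact; last exact: closed_ball_compact.
  apply: continuous_in_subspaceT => u; rewrite inE => /KI Iu.
  by apply: cinv; rewrite inE.
pose b x : R^o := if `[< chart_dom phi x >] then B (chart_fun phi x) else 0.
have bE x : chart_dom phi x -> b x = B (chart_fun phi x) by move=> dx;
  rewrite /b asboolT.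
have bK x : ~ K x -> b x = 0.
  move=> nK; rewrite /b; case: asboolP => // dx.
  apply: Bout => cx; apply: nK; exists (chart_fun phi x) => //.
  by rewrite fK// inE.
exists b; last by exists K => //; split=> // _ [u /sN/NU[_ +] <-].
split=> [psi Apsi k|x|]; last by rewrite bE.
  have [_ oIpsi _ _ [_ cinvpsi]] := charts _ Apsi.
  (* [M] is here a dummy parameter space, introduced so that the local criterion for [PCk]
     applies. *)
  apply: (@Ck_of_PCk R M _ p _ k ((b \o chart_inv psi) \o snd)).
  apply: PCk_local => -[x y] [_ /= Iy].
  have [dy|ndy] := pselect (chart_dom phi (chart_inv psi y)).
    have [W [oW Wp dW] Ck] := @smooth_param_chart_inv M psi k mA Apsi (x, y)
      Iy phi Aphi dy.
    exists W => //.
    apply: (@PCk_eq _ _ _ _ _ (B \o (fun q => chart_fun phi (chart_inv psi q.2))))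
      => //.
      by move=> q /dW dq /=; rewrite bE.
    apply: (PCk_comp oW openT) => //.
    have oT : open (snd @^-1` setT : set (M * 'rV[R]_m)) by exact: openT.
    pose c i (q : M * 'rV[R]_m) : R^o := q.2 0 i + - u0 0 i.
    have Cc1 i : PCk (snd @^-1` setT) k (c i).
      by apply: PCkD => //; [exact: PCk_coord|exact: PCk_cst].
    have -> : B \o snd = (fun q : M * 'rV[R]_m =>
        \prod_i flat 0 (s ^+ 2 + -1 * (c i q * c i q))).
      by apply/funext => q; apply: eq_bigr => i _; rewrite mulN1r expr2.
    apply: PCk_prod => // i; apply: PCk_flat => //; apply: PCkD => //;
      first exact: PCk_cst.
    by apply: PCkM => //; [exact: PCk_cst|exact: PCkM].
  (* Outside the domain of [phi] the point avoids [K], whose complement is open, so [b] is 0 around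
     it. *)
  have nK : ~ K (chart_inv psi y).
    by move=> [u /KI Iu e]; apply: ndy; rewrite -e; exact: invD.
  have oN : open (chart_img psi `&` chart_inv psi @^-1` (~` K)).
    by apply: open_setI_preimage => //; apply: closed_openC; exact: compact_closed.
  exists (snd @^-1` (chart_img psi `&` chart_inv psi @^-1` (~` K))) => //.
  apply: PCk_eq (PCk_cst _ k 0).
    by apply: open_comp => // q _; exact: cvg_snd.
  by move=> q [_ /= /bK ->].
by rewrite /b; case: asboolP.
Qed.

Lemma manifold_bumps : smooth_manifold A -> bumps R M.
Proof.
move=> mA p U nU; have [b [sb b0 bp] hK] := smooth_bump mA nU.
by exists b => //; split=> //; exact: smooth_fun_continuous.
Qed.

Definition is_bump (b : M -> R^o) := [/\ smooth_fun A b, forall x, 0 <= b x &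
  exists2 K, compact K & forall x, ~ K x -> b x = 0].

(** For each set of a countable base, numbered by an injection [f], one bump positive on it is
    chosen if there is any. A point [x] is reached because the positivity set of a bump at [x]
    contains a base set around [x]. *)
Lemma countable_bumps : smooth_manifold A -> exists b : nat -> M -> R^o,
  (forall i, is_bump (b i)) /\ forall x, exists i, 0 < b i x.
Proof.
move=> mA; have [_ [B /countable_injP[f finj] [Bo Bb]] _ _ _] := mA.
have [b hb] : {b : nat -> M -> R^o & forall i, is_bump (b i) /\
    forall S, B S -> f S = i -> (exists2 b', is_bump b' & forall x, S x -> 0 < b' x) ->
    forall x, S x -> 0 < b i x}.
  apply: (@choice _ _ (fun i b => is_bump b /\
    forall S, B S -> f S = i -> (exists2 b', is_bump b' & forall x, S x -> 0 < b' x) ->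
    forall x, S x -> 0 < b x)) => i.
  have [[S [BS fS [b' Hb' Sb']]]|h] := pselect (exists S, [/\ B S, f S = i &
      exists2 b', is_bump b' & forall x, S x -> 0 < b' x]).
    exists b'; split=> // S' BS' fS' _; suff -> : S' = S by [].
    by apply: finj; rewrite ?inE// fS.
  (* An index that numbers no suitable base set receives the zero bump. *)
  exists (fun=> 0); split=> [|S BS fS hS].
    split=> // [psi Apsi k|]; first exact: Ck_on_cst.
    by exists set0 => //; exact: compact0.
  by exfalso; apply: h; exists S.
exists b; split=> [i|x]; first by have [] := hb i.
have [b' [sb' b'0 b'x] [K [cK _] b'K]] := @smooth_bump x setT mA filterT.
have cb' := smooth_fun_continuous mA sb'.
have /Bb[S [BS Sx] SS] : nbhs x [set z | 0 < b' z].
  by apply: (cb' x [set t | 0 < t]); exact: lt_nbhsr.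
exists (f S); have [_ h] := hb (f S); apply: (h S BS) => //.
by exists b' => //; split=> //; exists K.
Qed.

End smooth_param.

(** * The action in local coordinates *)

Section action.
Variables (R : realType) (n m : nat) (G : topGroupType) (AG : set (chart G 'rV[R]_n)).
Variables (M : topologicalType) (AM : set (chart M 'rV[R]_m)).
Hypotheses (HG : lie_group AG) (HM : smooth_manifold AM).
Variable rho : G -> M -> M.
Hypothesis Hrho : smooth_action AG AM rho.

Lemma action_continuous : continuous (fun p : G * M => rho p.1 p.2).
Proof. by case: Hrho => _ _ []. Qed.

(** Near a group element the action is its coordinate expression, smooth in both variables,
    precomposed with a chart of the group; [PCk_pull] uses only the continuity of that chart. *)
Lemma smooth_param_action psi k : AM psi ->
  smooth_param AM (setT `*` chart_img psi) k (fun p :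
    G * 'rV[R]_m => rho p.1 (chart_inv psi p.2)).
Proof.
move=> Apsi p [_ Ip] chi Achi dchi.
have [_ _ chartsG coverG _] := lie_manifold HG.
have [_ _ charts cover _] := HM.
have [phi Aphi dphi] := coverG p.1.
have [odG oIG [fIG _] [fKG _] [cfunG cinvG]] := chartsG _ Aphi.
have [_ oI _ _ [_ cinv]] := charts _ Apsi; have [odchi _ _ _ _] := charts _ Achi.
have [_ srho] := action_smooth Hrho.
have PA : prod_atlas AG AM (prod_chart phi psi) by exists phi => //; exists psi.
have sm := srho _ chi PA Achi.
pose act_ch (u : 'rV[R]_n * 'rV[R]_m) := rho (chart_inv phi u.1) (chart_inv psi u.2).
pose Q := (chart_img phi `*` chart_img psi) `&` [set u | chart_dom chi (act_ch u)].
have oQ : open Q.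
  apply: open_setI_preimage => //; first exact: open_setX.
  move=> u; rewrite inE => -[Iu1 Iu2].
  apply: (@continuous_comp _ _ _ (fun u :
    'rV[R]_n * 'rV[R]_m => (chart_inv phi u.1, chart_inv psi u.2))
    (fun p : G * M => rho p.1 p.2)); last exact: action_continuous.
  apply: cvg_pair.
    apply: (@continuous_comp _ _ _ fst (chart_inv phi)); first exact: cvg_fst.
    by apply: cinvG; rewrite inE.
  apply: (@continuous_comp _ _ _ snd (chart_inv psi)); first exact: cvg_snd.
  by apply: cinv; rewrite inE.
pose tr (q : G * 'rV[R]_m) := (chart_fun phi q.1, q.2).
pose W := (chart_dom phi `*` setT) `&` tr @^-1` Q.
have oW : open W.
  apply: open_setI_preimage => //; first by apply: open_setX => //; exact: openT.
  move=> q; rewrite inE => -[dq _].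
    apply: (@pair_continuous_at _ _ _ (fun q :
    G * 'rV[R]_m => chart_fun phi q.1) snd); last exact: cvg_snd.
  apply: (@continuous_comp _ _ _ fst (chart_fun phi)); first exact: cvg_fst.
  by apply: cfunG; rewrite inE.
exists W => [|i].
  split=> //.
    split=> //; split=> /=; first by split=> //; exact: fIG.
    by rewrite /act_ch /= fKG// inE.
  by move=> q [[dq _] [_ /=]]; rewrite /act_ch /= fKG// inE.
apply: (@PCk_eq _ _ _ _ _ (fun q => chart_fun chi (act_ch (chart_fun phi q.1, q.2))
  0 i)) => //.
  by move=> q [[dq _] _]; rewrite /act_ch /= fKG// inE.
apply: (@PCk_pull _ _ _ _ Q W k (fun u => chart_fun chi (act_ch u) 0 i)
  (chart_fun phi)).
  by move=> q [[dq _] Qq]; split=> //; apply: cfunG; rewrite inE.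
apply: PCk_of_Ck_prod => //; apply: Ck_on_coord; exact: (sm k).
Qed.

End action.



Lemma Ck_on_const (R : realType) (V : normedModType R) (W : preTopologicalLmodType R)
  (U : set V) k (w : W) : Ck_on U k (fun=> w).
Proof.
elim: k w => [|k IH] w; first by split=> // x _; exact: cst_continuous.
split=> [x _|v]; first exact: cst_continuous.
exists (fun=> 0) => [x _|]; last exact: IH.
rewrite /dirderiv_at (_ : (fun h => _) = cst 0); first exact: cvg_cst.
by apply/funext => h; rewrite subrr scaler0.
Qed.

(** * Averaging over the group *)

Section smooth_algebra.
Variables (R : realType) (m : nat) (M : topologicalType) (A : set (chart M 'rV[R]_m)).
Hypothesis mA : smooth_manifold A.

(** With a dummy parameter space, this transports the rules of the [PCk] calculus to smooth
    functions on [M]. *)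
Lemma smooth_funP (f : M -> R^o) : smooth_fun A f <->
  forall psi, A psi -> forall k,
    PCk (X := 'rV[R]_m) (snd @^-1` chart_img psi) k ((f \o chart_inv psi) \o snd).
Proof.
have [_ _ charts _ _] := mA.
split=> [sf psi Apsi k|h psi Apsi k].
  have [_ oI _ _ _] := charts _ Apsi.
  by apply: PCk_of_Ck => //; exact: sf.
apply: (@Ck_of_PCk R _ _ (0 : 'rV[R]_m) _ k ((f \o chart_inv psi) \o snd)).
by apply: PCk_sub (h psi Apsi k) => p [].
Qed.

Let open_snd psi : A psi -> open (snd @^-1` chart_img psi : set ('rV[R]_m * 'rV[R]_m)).
Proof.
have [_ _ charts _ _] := mA => Apsi; have [_ oI _ _ _] := charts _ Apsi.
by apply: open_comp => // p _; exact: cvg_snd.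
Qed.

Lemma smooth_fun_cst (c : R) : smooth_fun A (fun=> c : R^o).
Proof. by move=> psi Apsi k; exact: Ck_on_cst. Qed.

Lemma smooth_funD (f g : M -> R^o) : smooth_fun A f -> smooth_fun A g ->
  smooth_fun A (fun x => f x + g x : R^o).
Proof.
move=> /smooth_funP sf /smooth_funP sg; apply/smooth_funP => psi Apsi k.
by apply: (PCkD (open_snd Apsi) (sf psi Apsi k) (sg psi Apsi k)).
Qed.

Lemma smooth_funM (f g : M -> R^o) : smooth_fun A f -> smooth_fun A g ->
  smooth_fun A (fun x => f x * g x : R^o).
Proof.
move=> /smooth_funP sf /smooth_funP sg; apply/smooth_funP => psi Apsi k.
by apply: (PCkM (open_snd Apsi) (sf psi Apsi k) (sg psi Apsi k)).
Qed.

Lemma smooth_funV (f : M -> R^o) : smooth_fun A f -> (forall x, f x != 0) ->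
  smooth_fun A (fun x => (f x)^-1 : R^o).
Proof.
move=> /smooth_funP sf f0; apply/smooth_funP => psi Apsi k.
by apply: (PCkV (open_snd Apsi) _ (sf psi Apsi k)) => p _; exact: f0.
Qed.

Lemma smooth_fun_flat n (f : M -> R^o) : smooth_fun A f ->
  smooth_fun A (fun x => flat n (f x) : R^o).
Proof.
move=> /smooth_funP sf; apply/smooth_funP => psi Apsi k.
by apply: (PCk_flat n (open_snd Apsi) (sf psi Apsi k)).
Qed.

Lemma smooth_fun_sum I (s : seq I) (f : I -> M -> R^o) :
  (forall i, smooth_fun A (f i)) -> smooth_fun A (fun x => \sum_(i <- s) f i x : R^o).
Proof.
move=> sf; elim: s => [|i s IH].
  by under eq_fun do rewrite big_nil; exact: smooth_fun_cst.
by under eq_fun do rewrite big_cons; exact: smooth_funD.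
Qed.

Lemma smooth_fun_prod I (s : seq I) (f : I -> M -> R^o) :
  (forall i, smooth_fun A (f i)) -> smooth_fun A (fun x => \prod_(i <- s) f i x : R^o).
Proof.
move=> sf; elim: s => [|i s IH].
  by under eq_fun do rewrite big_nil; exact: smooth_fun_cst.
by under eq_fun do rewrite big_cons; exact: smooth_funM.
Qed.

Lemma smooth_fun_local (f : M -> R^o) :
  (forall x : M, exists2 g : M -> R^o, smooth_fun A g & \forall z \near x, f z = g z) ->
  smooth_fun A f.
Proof.
move=> loc; apply/smooth_funP => psi Apsi k; apply: PCk_local => -[u y] /= Iy.
have [_ _ charts _ _] := mA; have [_ oI _ _ [_ cinv]] := charts _ Apsi.
have [g /smooth_funP sg] := loc (chart_inv psi y).
rewrite -nbhs_nearE nbhsE => -[B [oB By] fg].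
have oW := open_setI_preimage oI cinv oB.
have oW2 : open (snd @^-1` (chart_img psi `&` chart_inv psi @^-1` B) :
  set ('rV[R]_m * 'rV[R]_m)).
  by apply: open_comp => // p _; exact: cvg_snd.
exists (snd @^-1` (chart_img psi `&` chart_inv psi @^-1` B)) => //.
apply: (@PCk_eq _ _ _ _ _ ((g \o chart_inv psi) \o snd)) => //.
  by move=> [a b] [_ /= /fg ->].
by apply: PCk_sub (sg psi Apsi k) => p [].
Qed.

(** The sum is cut off at an index chosen separately for each point. Any valid cut-off gives the
    same value, so near a given point a common one can be used, which shows smoothness. *)
Lemma locally_finite_sum (f : nat -> M -> R^o) :
  (forall i, smooth_fun A (f i)) ->
  (forall x : M, exists n, \forall z \near x, forall i, (n <= i)%N -> f i z = 0) ->
  exists2 S : M -> R^o, smooth_fun A S &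
    forall n x, (forall i, (n <= i)%N -> f i x = 0) -> S x = \sum_(i <- iota 0 n) f i x.
Proof.
move=> sf lf.
pose P x n := forall i, (n <= i)%N -> f i x = 0.
have exP x : exists n, P x n.
  by have [n /nbhs_singleton h] := lf x; exists n.
have [N PN] := choice exP.
have SE n x : P x n -> \sum_(i <- iota 0 (N x)) f i x = \sum_(i <- iota 0 n) f i x.
  move=> Pn.
  have key a b : (a <= b)%N -> P x a ->
    \sum_(i <- iota 0 b) f i x = \sum_(i <- iota 0 a) f i x.
    move=> ab Pa; rewrite -(subnKC ab) iotaD big_cat /= add0n.
    rewrite (_ : \sum_(i <- iota a (b - a)) f i x = 0) ?addr0// big_seq big1// => i.
    by rewrite mem_iota => /andP[ai _]; exact: Pa.
  by have [le|/ltnW le] := leqP (N x) n; [rewrite -(key _ _ le)|rewrite (key _ _ le)].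
exists (fun x => \sum_(i <- iota 0 (N x)) f i x) => [|n x]; last exact: SE.
apply: smooth_fun_local => x; have [n hn] := lf x.
exists (fun x => \sum_(i <- iota 0 n) f i x); first exact: smooth_fun_sum.
by apply: filterS hn => z; exact: SE.
Qed.

End smooth_algebra.

(** * From a cocycle to its primitive *)

Section proper_cocycle.
Variables (R : realType) (n m : nat) (G : topGroupType) (AG : set (chart G 'rV[R]_n)).
Variables (M : topologicalType) (AM : set (chart M 'rV[R]_m)).
Hypotheses (HG : lie_group AG) (HM : smooth_manifold AM).
Variable rho : G -> M -> M.
Hypotheses (Hrho : smooth_action AG AM rho) (Hproper : proper_action rho).

Lemma PCk_action (f : M -> R^o) psi k : smooth_fun AM f -> AM psi ->
  PCk (setT `*` chart_img psi) k (fun p :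
    G * 'rV[R]_m => f (rho p.1 (chart_inv psi p.2))).
Proof.
move=> sf Apsi.
apply: (@PCk_smooth_fun _ _ _ _ _ _ _ k (fun p => rho p.1 (chart_inv psi p.2)) f HM sf).
exact: (smooth_param_action HG HM Hrho).
Qed.

Lemma smooth_fun_action (f : M -> R^o) g : smooth_fun AM f ->
  smooth_fun AM (fun x => f (rho g x)).
Proof.
move=> sf psi Apsi k.
exact: (@Ck_of_PCk R G _ g _ k _ (PCk_action k sf Apsi)).
Qed.

Lemma Cinfty_actE g (f : Cinfty AM) x : Cinfty_act AM rho g f x = f (rho g^-1%g x).
Proof.
rewrite /Cinfty_act.
have h : (fun x => f (rho g^-1%g x)) \in @smooth_pred R m M AM.
  apply/asboolP; apply: smooth_fun_action; apply/asboolP; exact: Cinfty_smooth.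
by rewrite -[LHS]/(val (insubd _ _) x) insubdK.
Qed.

(** Properness enters here. If [z] runs over a closed ball, with compact image [L] in [M], the
    elements [g] that move a point of [L] into [K] lie in the projection of the preimage of [K x L],
    which is compact. *)
Lemma lsupp_action (b : M -> R^o) (h : G * 'rV[R]_m -> R^o) psi : is_bump AM b ->
  AM psi ->
  lsupp (chart_img psi) (fun p : G * 'rV[R]_m => h p * b (rho p.1 (chart_inv psi p.2))).
Proof.
move=> [sb b0 [K cK bK]] Apsi y Iy.
have [_ _ charts _ _] := HM; have [_ oI _ _ [_ cinv]] := charts _ Apsi.
have [r r0 KI] := closed_ball_sub_open oI Iy.
pose L := chart_inv psi @` closed_ball y r.
have cL : compact L.
  apply: continuous_compact; last exact: closed_ball_compact.
  apply: continuous_in_subspaceT => u; rewrite inE => /KI Iu.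
  by apply: cinv; rewrite inE.
have [_ /(_ _ (compact_setX cK cL)) cP] := Hproper.
exists (fst @` ((fun p : G * M => (rho p.1 p.2, p.2)) @^-1` (K `*` L))).
  apply: continuous_compact => //; apply: continuous_subspaceT => p; exact: cvg_fst.
have : nbhs y (closed_ball y r) by exact: nbhs_closed_ball.
apply: filterS => z yz g ng /=; rewrite bK ?mulr0// => Kg.
apply: ng; exists (g, chart_inv psi z) => //=; split=> //=.
by exists z.
Qed.


Lemma CinftyD (u v : Cinfty AM) x : (u + v) x = u x + v x.
Proof. by rewrite -[LHS]/(val (u + v) x) raddfD. Qed.

Lemma CinftyB (u v : Cinfty AM) x : (u - v) x = u x - v x.
Proof. by rewrite -[LHS]/(val (u - v) x) raddfB. Qed.

Lemma Cinfty0 x : (0 : Cinfty AM) x = 0.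
Proof. by rewrite -[LHS]/(val (0 : Cinfty AM) x) raddf0. Qed.

Lemma cochain1E (lam : cochain G (Cinfty AM) 1) (a : 'I_1 -> G) :
  lam a = lam (fun=> a ord0).
Proof. by congr lam; apply/funext => i; rewrite ord1. Qed.

Lemma cocycle_eq (lam : cochain G (Cinfty AM) 1) a b x :
  coboundary (Cinfty_act AM rho) lam = 0 ->
  lam (fun=> a * b)%g x = lam (fun=> a) x + lam (fun=> b) (rho a^-1%g x).
Proof.
pose al (i : 'I_2) := if i == ord0 then a else b.
move=> /(congr1 (fun mu : cochain G (Cinfty AM) 2 => mu al x)).
have e0 : lam (fun j => al (lift ord0 j)) = lam (fun=> b) by rewrite cochain1E.
have e1 : lam (Defs.merge (ord0 : 'I_1) al) = lam (fun=> a * b)%g by rewrite cochain1E.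
have e2 : lam (fun j => al (widen_ord (leqnSn 1) j)) =
  lam (fun=> a) by rewrite cochain1E.
rewrite /coboundary big_ord1 e0 e1 e2 expr1 sqrrN expr1n scale1r scaleN1r.
rewrite CinftyD CinftyB Cinfty_actE Cinfty0 /al/=.
lra.
Qed.


Lemma continuous_group_mul : continuous (fun p : G * G => (p.1 * p.2)%g).
Proof. by case: HG => _ []. Qed.

Lemma continuous_group_inv : continuous (fun g : G => g^-1%g).
Proof. by case: HG => _ _ []. Qed.

(** Covers both averages of the construction: [L] constant equal to 1 and [L] given by the
    cocycle. *)
Lemma smooth_fun_average (J : (G -> R) -> R) (L : G -> Cinfty AM) (b : M -> R^o) :
  (forall a f g, Cc f -> Cc g -> J (fun x => a * f x + g x) = a * J f + J g) ->
  (forall f, Cc f -> (forall x, 0 <= f x) -> 0 <= J f) ->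
  continuous L -> is_bump AM b ->
  (forall x, Cc (fun g => L g x * b (rho g x) : R)) /\
  smooth_fun AM (fun x => J (fun g => L g x * b (rho g x)) : R^o).
Proof.
move=> Jlin Jpos cL bb; have [sb _ _] := bb.
have [_ _ charts cover _] := HM.
have bG := manifold_bumps (lie_manifold HG).
pose f psi (p : G * 'rV[R]_m) : R^o :=
  L p.1 (chart_inv psi p.2) * b (rho p.1 (chart_inv psi p.2)).
have Cf psi k : AM psi -> PCk (setT `*` chart_img psi) k (f psi).
  move=> Apsi; have cpsi := charts _ Apsi; have [_ oI _ _ _] := cpsi.
  apply: PCkM; [exact: open_setX openT oI| |exact: PCk_action].
  exact: (@PCk_chart_derivative R m M AM G L psi [::] k).
have sf psi : AM psi -> lsupp (chart_img psi) (f psi).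
  move=> Apsi; exact: (lsupp_action (fun p => L p.1 (chart_inv psi p.2))).
split=> [x|psi Apsi k].
  have [psi Apsi dx] := cover x; have [_ _ [fI _] [fK _] _] := charts _ Apsi.
  have := Cc_slice _ (sf psi Apsi) (fI _ dx).
  rewrite /f /= fK ?inE//; apply => p; exact: (PCk_cont (Cf psi 0 Apsi)).
have [_ oI _ _ _] := charts _ Apsi.
exact: (functional_Ck bG Jlin Jpos oI (Cf psi k Apsi) (sf psi Apsi)).
Qed.

Lemma cocycle_primitive (lam : cochain G (Cinfty AM) 1) :
  smooth_cochains AG lam -> coboundary (Cinfty_act AM rho) lam = 0 ->
  exists f : Cinfty AM, forall g, lam (fun=> g) = Cinfty_act AM rho g f - f.
Proof.
move=> slam lam0.
have [hG _ chartsG coverG _] := lie_manifold HG.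
have bG := manifold_bumps (lie_manifold HG).
(* A nonzero reference function, by which the covering indices are normalised. *)
have [f1 [cf1 f1_ge0 f11] [K1 [cK1 _] f1K]] := bG 1%g setT filterT.
have pf1 : posf f1 by split; [split=> //; split=> //; exists K1|exists 1%g].
have [J [Jlin Jpos Jinv Jgt0]] :=
  haar_functional continuous_group_mul continuous_group_inv hG bG pf1.
have [b [bb bcov]] := countable_bumps HM.
have one_smooth : (fun=> 1 : R^o) \in @smooth_pred R m M AM.
  by apply/asboolP; exact: smooth_fun_cst.
pose one : G -> Cinfty AM := fun=> MkCinfty one_smooth.
pose L (g : G) : Cinfty AM := lam (fun=> g^-1%g).
have c1 : continuous one by move=> g; exact: cvg_cst.
have cL : continuous L.
  move=> g; apply: (@continuous_comp _ _ _ (fun g :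
    G => g^-1%g) (fun g => lam (fun=> g))).
    exact: continuous_group_inv.
  exact: (smooth_cochain1_continuous chartsG coverG slam).
pose H i x : R^o := J (fun g => one g x * b i (rho g x)).
pose F i x : R^o := J (fun g => L g x * b i (rho g x)).
have CH i := (smooth_fun_average Jlin Jpos c1 (bb i)).1.
have sH i : smooth_fun AM (H i) := (smooth_fun_average Jlin Jpos c1 (bb i)).2.
have CF i := (smooth_fun_average Jlin Jpos cL (bb i)).1.
have sF i : smooth_fun AM (F i) := (smooth_fun_average Jlin Jpos cL (bb i)).2.
have rhoM := actionM Hrho; have rho1 := action1 Hrho.
have b_ge0 i x : 0 <= b i x by have [_ + _] := bb i.
have H_ge0 i x : 0 <= H i x.
  by apply: Jpos => // g; rewrite mul1r.
have H_gt0 i x : 0 < b i x -> 0 < H i x.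
  move=> bx; apply: Jgt0 => // [g|]; first by rewrite mul1r.
  by exists 1%g; rewrite rho1 mul1r.
have H_inv i a x : H i (rho a x) = H i x.
  rewrite /H -(Jinv (fun g => one g x * b i (rho g x)) a)//.
  by congr J; apply/funext => g; rewrite rhoM.
have F_inv i a x : F i (rho a^-1%g x) = F i x - lam (fun=> a) x * H i x.
  have -> : F i (rho a^-1%g x) = J (fun g => - lam (fun=> a)
    x * (one g x * b i (rho g x)) +
      L g x * b i (rho g x)).
    (* The right-hand integrand is translated by [a^-1]. Then [L (g a^-1) = lam (a g^-1)], and the
       cocycle identity splits off [lam a x], leaving [lam (g^-1)] at [a^-1 x]. *)
    rewrite /F -[RHS](Jinv _ a^-1%g); last exact: Cc_lin.
    congr J; apply/funext => g; rewrite -rhoM /L.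
    have := @cocycle_eq lam a g^-1%g x lam0; rewrite invgM invgK => ->.
    rewrite mul1r; ring.
  by rewrite Jlin// addrC mulNr.
pose w i x : R^o := \prod_(j <- iota 0 i) flat 0 (i.+1%:R^-1 + -1 * H j x).
have sw i : smooth_fun AM (w i).
  apply: smooth_fun_prod => // j; apply: smooth_fun_flat => //;
    apply: smooth_funD => //.
    exact: smooth_fun_cst.
  by apply: smooth_funM => //; exact: smooth_fun_cst.
have w_ge0 i x : 0 <= w i x.
  by apply: prodr_ge0 => j _; have /andP[] := flat_bound 0 (i.+1%:R^-1 + -1 * H j x).
have w_inv i a x : w i (rho a x) = w i x.
  by rewrite /w; under eq_bigr do rewrite H_inv.
(* Some [H j] is positive at [x], hence bounded below near [x]. Once [1 / (i + 1)] is below this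
   bound and [j < i], so that [j] occurs in the product, the factor of index [j] makes [w i]
   vanish. *)
have w_fin (x : M) : exists N, \forall z \near x, forall i, (N <= i)%N -> w i z = 0.
  have [j bj] := bcov x; have Hj := H_gt0 _ _ bj.
  have Hj2 : 0 < H j x / 2 by rewrite divr_gt0.
  have [N hn] : exists N : nat, N.+1%:R^-1 < H j x / 2.
    have [N hN] := ltr_add_invr Hj2; exists N; move: hN; rewrite add0r.
    exact.
  exists (maxn N j.+1).
  have cH := smooth_fun_continuous HM (sH j).
  have : \forall z \near x, H j x / 2 < H j z.
    by apply: (cH x [set t | H j x / 2 < t]); apply: lt_nbhsr; lra.
  apply: filterS => z Hz i; rewrite geq_max => /andP[ni ji].
  have jin : j \in iota 0 i by rewrite mem_iota.
  rewrite /w (perm_big _ (perm_to_rem jin)) big_cons /= /flat ltNge.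
  suff -> : i.+1%:R^-1 + -1 * H j z <= 0 by rewrite mul0r.
  have iN : (i.+1%:R^-1 : R) <= N.+1%:R^-1 by rewrite lef_pV2 ?posrE// ler_nat.
  by rewrite mulN1r subr_le0 (le_trans iN)// (le_trans (ltW hn))// ltW.
have wQ_fin (Q : nat -> M -> R^o) (x : M) :
    exists N, \forall z \near x, forall i, (N <= i)%N -> w i z * Q i z = 0.
  have [N hn] := w_fin x; exists N.
  by apply: filterS hn => z hz i /hz ->; rewrite mul0r.
have [den sden denE] := locally_finite_sum HM
  (fun i => smooth_funM HM (sw i) (sH i)) (wQ_fin H).
have [num snum numE] := locally_finite_sum HM
  (fun i => smooth_funM HM (sw i) (sF i)) (wQ_fin F).
have fin x : exists N, forall i, (N <= i)%N -> w i x = 0.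
  by have [N /nbhs_singleton hn] := w_fin x; exists N.
have den_inv a x : den (rho a x) = den x.
  have [N hn] := fin x.
  rewrite (denE N x) => [|i /hn ->]; last by rewrite mul0r.
  rewrite (denE N (rho a x)) => [|i ni]; last by rewrite w_inv hn// mul0r.
  by apply: eq_bigr => i _; rewrite w_inv H_inv.
have num_inv a x : num (rho a^-1%g x) = num x - lam (fun=> a) x * den x.
  have [N hn] := fin x.
  rewrite (denE N x) => [|i /hn ->]; last by rewrite mul0r.
  rewrite (numE N x) => [|i /hn ->]; last by rewrite mul0r.
  rewrite (numE N (rho a^-1%g x)) => [|i ni]; last by rewrite w_inv hn// mul0r.
  rewrite mulr_sumr -sumrB; apply: eq_bigr => i _; rewrite w_inv F_inv; ring.
have den_gt0 x : 0 < den x.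
  have [N hn] := fin x.
  have exH : exists i, 0 < H i x by have [i /H_gt0] := bcov x; exists i.
  (* At the first [i] with [H i x > 0] all earlier [H j x] are 0, so every factor of [w i x] is
     [flat 0 (1 / (i + 1)) > 0]. *)
  case: (ex_minnP exH) => i Hi imin.
  have wi : 0 < w i x.
    rewrite /w big_seq prodr_gt0// => j; rewrite mem_iota add0n => /andP[_ ji].
    have -> : H j x = 0.
      apply/eqP; rewrite eq_le H_ge0 andbT leNgt; apply/negP => /imin.
      by rewrite leqNgt ji.
    by rewrite mulr0 addr0 /flat invr_gt0 ltr0n /= expr0 mul1r expR_gt0.
  rewrite (denE N x) => [|j /hn ->]; last by rewrite mul0r.
  (* As [w i x] is nonzero, [i] lies below the cut-off, and its term does occur in the finite
     sum. *)
  have iin : i \in iota 0 N.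
    rewrite mem_iota add0n /= ltnNge; apply/negP => /hn wi0.
    by rewrite wi0 ltxx in wi.
  rewrite (perm_big _ (perm_to_rem iin)) big_cons /= ltr_wpDr//.
    by rewrite sumr_ge0// => j _; rewrite mulr_ge0.
  by rewrite mulr_gt0.
have sf : (fun x => -1 * (num x * (den x)^-1) : R^o) \in @smooth_pred R m M AM.
  apply/asboolP; apply: smooth_funM => //; first exact: smooth_fun_cst.
  by apply: smooth_funM => //; apply: smooth_funV => // x; rewrite gt_eqF.
have [f fE] : exists f : Cinfty AM, forall x, f x = -1 * (num x * (den x)^-1).
  by exists (MkCinfty sf).
exists f => g; apply: val_inj; apply/funext => x.
rewrite -[RHS]/((Cinfty_act AM rho g f - f) x).
rewrite CinftyB Cinfty_actE !fE num_inv den_inv.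
(* [N - c * D] and [D] are the values of [num] and [den] at [g^-1 x]; the sign of the primitive
   comes from the minus sign in [num_inv]. *)
have key (N D c : R) : D != 0 ->
    c = -1 * ((N - c * D) * D^-1) - -1 * (N * D^-1) by move=> D0; field.
by apply: key; rewrite gt_eqF.
Qed.

End proper_cocycle.

Theorem theorem7 (R : realType) (n m : nat)
    (G : topGroupType) (AG : set (chart G 'rV[R]_n)) (HG : lie_group AG)
    (M : topologicalType) (AM : set (chart M 'rV[R]_m))
    (HM : smooth_manifold AM)
    (rho : G -> M -> M) (Hrho : smooth_action AG AM rho)
    (Hproper : proper_action rho) :
  cohomology AG (Cinfty_act AM rho) 1 =
  [set cohomology_class AG (Cinfty_act AM rho) (0 : cochain G (Cinfty AM) 1)].
Proof.
have act_coboundary (u : cochain G (Cinfty AM) 0) (a : 'I_1 -> G) :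
    coboundary (Cinfty_act AM rho) u a =
    Cinfty_act AM rho (a ord0) (u (fun j => a (lift ord0 j))) -
    u (fun j => a (widen_ord (leqnSn 0) j)).
  by rewrite /coboundary big_ord0 addr0 expr1 scaleN1r.
have actB (g : G) (u v : Cinfty AM) :
    Cinfty_act AM rho g (u - v) = Cinfty_act AM rho g u - Cinfty_act AM rho g v.
  apply: val_inj; apply/funext => x.
  rewrite -[RHS]/((Cinfty_act AM rho g u - Cinfty_act AM rho g v) x).
  rewrite -[LHS]/(Cinfty_act AM rho g (u - v) x).
  by rewrite CinftyB !(Cinfty_actE HG HM Hrho) CinftyB.
(* There is only one map from ['I_0] to [G], so a 0-cochain is a single element of the module, and
   it is smooth as a constant. *)
have cst0 (u : cochain G (Cinfty AM) 0) : u = fun=> u (fun=> 1%g).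
  by apply/funext => a; congr u; apply/funext => -[].
have smooth0 (u : cochain G (Cinfty AM) 0) : smooth_cochains AG u.
  by rewrite (cst0 u) => phi _ k; exact: Ck_on_const.
have cobB (u v : cochain G (Cinfty AM) 0) :
    coboundary (Cinfty_act AM rho) (u - v) =
    coboundary (Cinfty_act AM rho) u - coboundary (Cinfty_act AM rho) v.
  apply/funext => a; rewrite act_coboundary.
  rewrite -[RHS]/(coboundary _ u a - coboundary _ v a) !act_coboundary.
  rewrite -[(u - v) _]/(u _ - v _) -[(u - v) (fun j => a (widen_ord _ j))]/(u _ - v _).
  rewrite actB [in LHS]opprB [in RHS]opprB [LHS]addrACA [RHS]addrACA.
  by congr (_ + _); exact: addrC.
have cob0 : coboundary (Cinfty_act AM rho) (0 : cochain G (Cinfty AM) 0) = 0.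
  by have := cobB 0 0; rewrite !subrr.
have cobD (u v : cochain G (Cinfty AM) 0) :
    coboundary (Cinfty_act AM rho) (u + v) =
    coboundary (Cinfty_act AM rho) u + coboundary (Cinfty_act AM rho) v.
  by have c := cobB 0 v; have := cobB u (0 - v); rewrite c cob0 !sub0r !opprK.
apply/seteqP; split=> [_ [lam [slam lam0] <-]|_ ->].
  have [f fE] := cocycle_primitive HG HM Hrho Hproper slam lam0.
  pose u : cochain G (Cinfty AM) 0 := fun=> f.
  have cu : coboundary (Cinfty_act AM rho) u = lam.
    by apply/funext => a; rewrite act_coboundary (cochain1E lam) fE.
  (* Since [lam] is the coboundary of [u], primitives of [mu - lam] and of [mu] differ by [u]. *)
  apply/seteqP; split=> mu [v _ vE].
    by exists (v + u); [exact: smooth0|rewrite cobD vE cu subrK subr0].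
  by exists (v - u); [exact: smooth0|rewrite cobB vE cu subr0].
(* Conversely, the class of 0 occurs because 0 is itself a smooth cocycle. *)
exists 0 => //; split; first by move=> phi _ k; exact: Ck_on_const.
have cob10 (a : 'I_2 -> G) : coboundary (Cinfty_act AM rho) (0 :
  cochain G (Cinfty AM) 1) a = 0.
  have a0 g : Cinfty_act AM rho g 0 = 0 by have := actB g 0 0; rewrite !subrr.
  by rewrite /coboundary big_ord1 a0 !scaler0 !addr0.
by apply/funext.
Qed.
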